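(* Let $(R,\alpha)$ be a multiplicative Hom-Lie conformal superalgebra, and let $\mathrm{Der}(R)=\bigoplus_{k\ge 0}\mathrm{Der}_{\alpha^k}(R)$. Then $(\mathrm{Der}(R),\alpha')$ is a Hom-Lie conformal superalgebra with respect to the bracket $$[D_\lambda D']_\mu(a)=D_\lambda(D'_{\mu-\lambda}a)-(-1)^{|D||D'|}D'_{\mu-\lambda}(D_\lambda a),\qquad a\in R,$$ where $\alpha'(D)=D\circ\alpha$.
   Context: All vector spaces are over $\mathbb{C}$; $|\cdot|\in\mathbb{Z}_2$ denotes parity, and formulas involving parities are for homogeneous elements and extended linearly. A Hom-Lie conformal superalgebra is a $\mathbb{Z}_2$-graded $\mathbb{C}[\partial]$-module $R=R_{\bar 0}\oplus R_{\bar 1}$ with an even linear endomorphism $\alpha$ with $\alpha\partial=\partial\alpha$ and a $\mathbb{C}$-linear map $R\otimes R\to\mathbb{C}[\lambda]\otimes R$, $a\otimes b\mapsto[a_\lambda b]$, with $[(R_\phi)_\lambda R_\varphi]\subseteq R_{\phi+\varphi}[\lambda]$, such that: (i) $[\partial a_\lambda b]=-\lambda[a_\lambda b]$ and $[a_\lambda\partial b]=(\partial+\lambda)[a_\lambda b]$; (ii) $[a_\lambda b]=-(-1)^{|a||b|}[b_{-\lambda-\partial}a]$ (if $[b_\nu a]=\sum_n\nu^nc_n$ then $[b_{-\lambda-\partial}a]=\sum_n(-\lambda-\partial)^nc_n$); (iii) $[\alpha(a)_\lambda[b_\mu c]]=[[a_\lambda b]_{\lambda+\mu}\alpha(c)]+(-1)^{|a||b|}[\alpha(b)_\mu[a_\lambda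 c]]$. It is multiplicative if $\alpha([a_\lambda b])=[\alpha(a)_\lambda\alpha(b)]$ for all $a,b\in R$. A Hom-conformal linear map $D$ of degree $\theta\in\mathbb{Z}_2$ on $R$ is a $\mathbb{C}$-linear map $D_\lambda:R\to R[\lambda]$ with $D_\lambda\partial=(\partial+\lambda)D_\lambda$, $D_\lambda(R_\phi)\subseteq R_{\phi+\theta}[\lambda]$ and $D_\lambda\alpha=\alpha D_\lambda$; $|D|=\theta$. Such maps form a $\mathbb{Z}_2$-graded $\mathbb{C}[\partial]$-module via $(\partial D)_\lambda=-\lambda D_\lambda$. For $k\ge0$, $D$ is an $\alpha^k$-derivation if in addition $$D_\lambda([a_\mu b])=[D_\lambda(a)_{\lambda+\mu}\alpha^k(b)]+(-1)^{|a||D|}[\alpha^k(a)_\mu D_\lambda(b)]\quad\text{for all } a,b\in R,$$ and $\mathrm{Der}_{\alpha^k}(R)$ is the set of $\alpha^k$-derivations. The bracket and $\alpha'$ on $\mathrm{Der}(R)$ are extended (bi)linearly from the summands; $(D\circ\alpha)_\lambda=D_\lambda\circ\alpha$.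
   Formalization: As stated the bracket [D_λ D'] may fail to be polynomial in λ; the full conclusion is proved when all these brackets are polynomial, in particular for R finitely generated over C[∂]; in general polynomiality and skew-symmetry hold after evaluation at each a in R, all other axioms unchanged. *)

(* Defs.v *)
From HB Require Import structures.
From mathcomp Require Import all_boot all_order all_algebra.
From mathcomp Require Import boolp classical_sets functions reals.
From mathcomp Require Import complex.

Set Implicit Arguments.
Unset Strict Implicit.
Unset Printing Implicit Defensive.

Import GRing.Theory.
Local Open Scope ring_scope.

(* An element of V[lambda] is represented by its coefficient sequence
   p : nat -> V, subject to fin_supp; an element of V[lambda, mu] by the array
   x : nat -> nat -> V, where x i j is the coefficient of lambda^i mu^j.
   Z/2 is represented by bool, with false for the even degree; the sum of
   degrees is (+) and the product is &&. *)

Section CoefficientSequences.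
Variables (C : pzRingType) (V : lmodType C).

Definition fin_supp (p : nat -> V) : Prop :=
  exists N, forall n, (N <= n)%N -> p n = 0.

(* lambda * p *)
Definition mulX (p : nat -> V) : nat -> V :=
  fun n => if n is n'.+1 then p n' else 0.

(* Coefficient of lambda^i mu^j in sum_(n, m) lambda^n (mu + s lambda)^m x_(n,m);
   only s = 1 and s = -1 are used. *)
Definition subst_add (s : C) (x : nat -> nat -> V) (i j : nat) : V :=
  \sum_(t < i.+1) (s ^+ t * 'C(j + t, j)%:R) *: x (i - t)%N (j + t)%N.

(* Coefficient of lambda^n in sum_(m < N) (- lambda - d)^m (c m); the terms
   with m < n vanish since the binomial coefficient does. *)
Definition subst_opp (d : V -> V) (c : nat -> V) (N n : nat) : V :=
  \sum_(m < N) ((-1) ^+ m * 'C(m, n)%:R) *: iter (m - n) d (c m).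

End CoefficientSequences.

Section HomLieConformalSuperalgebra.
Variables (C : fieldType) (V : lmodType C).
(* d is the action of the indeterminate of C[d] on the C[d]-module V, and
   br a b n is the coefficient of lambda^n in [a_lambda b]. *)
Variables (d al : {linear V -> V}) (gr : bool -> V -> Prop).
Variable br : V -> V -> nat -> V.

Record is_superspace : Prop := IsSuperspace {
  gr0 : forall p, gr p 0;
  grP : forall p (c : C) u v, gr p u -> gr p v -> gr p (c *: u + v);
  gr_sum : forall v, exists v0 v1, [/\ gr false v0, gr true v1 & v = v0 + v1];
  gr_direct : forall v, gr false v -> gr true v -> v = 0
}.

(* All the axioms except the polynomiality of [a_lambda b] in lambda and the
   skew-symmetry; none of these involves an infinite sum, so they make sense
   for a bracket with values in the formal power series V[[lambda]]. *)
Record hlcs_core : Prop := HLCSCore {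
  core_super : is_superspace;
  core_d_even : forall p v, gr p v -> gr p (d v);
  core_al_even : forall p v, gr p v -> gr p (al v);
  core_al_d : forall v, al (d v) = d (al v);
  core_br_linl : forall (c : C) a a' b n,
    br (c *: a + a') b n = c *: br a b n + br a' b n;
  core_br_linr : forall (c : C) a b b' n,
    br a (c *: b + b') n = c *: br a b n + br a b' n;
  core_br_gr : forall p q a b n, gr p a -> gr q b -> gr (p (+) q) (br a b n);
  core_br_dl : forall a b n, br (d a) b n = - mulX (br a b) n;
  core_br_dr : forall a b n, br a (d b) n = d (br a b n) + mulX (br a b) n;
  core_jacobi : forall p q a b c i j, gr p a -> gr q b ->
    br (al a) (br b c j) i =
      subst_add 1 (fun n m => br (br a b n) (al c) m) i j
      + (-1) ^+ (p && q) *: br (al b) (br a c i) j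
}.

Record is_hlcs : Prop := IsHLCS {
  hlcs_to_core : hlcs_core;
  br_poly : forall a b, fin_supp (br a b);
  br_skew : forall p q a b N, gr p a -> gr q b ->
    (forall n, (N <= n)%N -> br b a n = 0) ->
    forall n, br a b n = - ((-1) ^+ (p && q) *: subst_opp d (br b a) N n)
}.

End HomLieConformalSuperalgebra.

Record homLieConfSuper (C : fieldType) := HomLieConfSuper {
  hlcs_sort :> lmodType C;
  hlcs_d : {linear hlcs_sort -> hlcs_sort};
  hlcs_al : {linear hlcs_sort -> hlcs_sort};
  hlcs_gr : bool -> hlcs_sort -> Prop;
  hlcs_br : hlcs_sort -> hlcs_sort -> nat -> hlcs_sort;
  hlcs_axioms : is_hlcs hlcs_d hlcs_al hlcs_gr hlcs_br
}.

Definition multiplicative (C : fieldType) (R : homLieConfSuper C) : Prop :=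
  forall (a b : R) n,
    hlcs_al R (hlcs_br a b n) = hlcs_br (hlcs_al R a) (hlcs_al R b) n.

(* R is finitely generated as a C[d]-module. *)
Definition finitely_generated (C : fieldType) (R : homLieConfSuper C) : Prop :=
  exists s : seq R, forall v : R, exists f : nat -> {poly C},
    v = \sum_(i < size s) \sum_(n < size (f i))
          (f i)`_n *: iter n (hlcs_d R) s`_i.

Section Derivations.
Variables (C : fieldType) (R : homLieConfSuper C).
Local Notation d := (hlcs_d R).
Local Notation al := (hlcs_al R).
Local Notation gr := (@hlcs_gr C R).
Local Notation br := (@hlcs_br C R).

(* D a n is the coefficient of lambda^n in D_lambda(a). *)
Implicit Type D : R -> nat -> R.

Record is_homconf (theta : bool) D : Prop := IsHomConf {
  homconf_lin : forall (c : C) a b n, D (c *: a + b) n = c *: D a n + D b n;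
  homconf_poly : forall a, fin_supp (D a);
  homconf_d : forall a n, D (d a) n = d (D a n) + mulX (D a) n;
  homconf_gr : forall p a n, gr p a -> gr (p (+) theta) (D a n);
  homconf_al : forall a n, D (al a) n = al (D a n)
}.

Record is_der (k : nat) (theta : bool) D : Prop := IsDer {
  der_homconf : is_homconf theta D;
  der_leibniz : forall p a b i j, gr p a ->
    D (br a b j) i =
      subst_add 1 (fun n m => br (D a n) (iter k al b) m) i j
      + (-1) ^+ (p && theta) *: br (iter k al a) (D b i) j
}.

(* Der_(al^k)(R), consisting of the sums of an even and an odd derivation. *)
Definition in_Der (k : nat) D : Prop :=
  exists D0 D1, [/\ is_der k false D0, is_der k true D1 & D = D0 + D1].

(* The external direct sum over k of the Der_(al^k)(R): all the summands lie
   in the same space of maps, and X k is the k-th component of X. *)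
Definition in_DerSum (X : nat -> R -> nat -> R) : Prop :=
  (forall k, in_Der k (X k)) /\ (exists N, forall k, (N <= k)%N -> X k = 0).

Definition derSum_pred : {pred nat -> R -> nat -> R} := fun X => `[< in_DerSum X >].

Lemma fin_supp_lin (c : C) (p q : nat -> R) :
  fin_supp p -> fin_supp q -> fin_supp (c *: p + q).
Proof.
move=> [N hN] [M hM]; exists (maxn N M) => n; rewrite geq_max => /andP[n1 n2].
by rewrite addrfctE scalrfctE hN // hM // scaler0 addr0.
Qed.

Lemma gr_super : is_superspace gr.
Proof. exact: core_super (hlcs_to_core (hlcs_axioms R)). Qed.

Lemma subst_add_lin (c s : C) (x y : nat -> nat -> R) i j :
  subst_add s (fun n m => c *: x n m + y n m) i j =
  c *: subst_add s x i j + subst_add s y i j.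
Proof.
rewrite /subst_add scaler_sumr -big_split /=; apply: eq_bigr => t _.
by rewrite scalerDr !scalerA mulrC.
Qed.

Lemma is_der0 k theta : is_der k theta 0.
Proof.
have [bl br'] := (core_br_linl (hlcs_to_core (hlcs_axioms R)),
                  core_br_linr (hlcs_to_core (hlcs_axioms R))).
have b0l b n : br 0 b n = 0.
  by apply: (@addIr _ (br 0 b n)); have := bl 1 0 0 b n; rewrite !scale1r !add0r.
have b0r b n : br b 0 n = 0.
  by apply: (@addIr _ (br b 0 n)); have := br' 1 b 0 0 n; rewrite !scale1r !add0r.
split; first split.
- by move=> c a b n; rewrite /= scaler0 addr0.
- by move=> a; exists 0%N.
- by move=> a [|n]; rewrite /= linear0 addr0.
- by move=> p a n _; exact: (gr0 gr_super).
- by move=> a n; rewrite /= linear0.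
move=> p a b i j _; rewrite [LHS]/= b0r scaler0 addr0.
by rewrite /subst_add big1 // => t _; rewrite b0l scaler0.
Qed.

Lemma is_der_lin k theta (c : C) D D' :
  is_der k theta D -> is_der k theta D' -> is_der k theta (c *: D + D').
Proof.
have [bl br'] := (core_br_linl (hlcs_to_core (hlcs_axioms R)),
                  core_br_linr (hlcs_to_core (hlcs_axioms R))).
move=> [[h1 h2 h3 h4 h5] h6] [[g1 g2 g3 g4 g5] g6].
have E a n : (c *: D + D') a n = c *: D a n + D' a n by [].
split; first split.
- move=> e a b n; rewrite !E h1 g1 !scalerDr !scalerA [c * e]mulrC.
  by rewrite -!addrA; congr (_ + _); rewrite addrCA.
- by move=> a; exact: (@fin_supp_lin c (D a) (D' a)).
- move=> a n; rewrite !E h3 g3 linearP scalerDr -!addrA; congr (_ + _).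
  rewrite addrCA; congr (_ + _).
  by case: n => [|n] /=; rewrite ?scaler0 ?addr0.
- by move=> p a n pa; apply: (grP gr_super); [exact: h4|exact: g4].
- by move=> a n; rewrite !E h5 g5 linearP.
move=> p a b i j pa; rewrite !E (h6 p) // (g6 p) // br'.
have -> : subst_add 1 (fun n m => br ((c *: D + D') a n) (iter k al b) m) i j =
  subst_add 1 (fun n m => c *: br (D a n) (iter k al b) m
                         + br (D' a n) (iter k al b) m) i j.
  by apply: eq_bigr => t _; rewrite E bl.
rewrite subst_add_lin !scalerDr !scalerA [c * _]mulrC -!addrA.
by congr (_ + _); rewrite addrCA.
Qed.

Lemma derSum_submod : submod_closed derSum_pred.
Proof.
split.
  apply/asboolP; split; last by exists 0%N.
  by move=> k; exists 0, 0; split; [exact: is_der0|exact: is_der0|rewrite addr0].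
move=> c X Y /asboolP[hX [N hN]] /asboolP[hY [M hM]]; apply/asboolP; split.
  move=> k; have [D0 [D1 [a0 a1 e]]] := hX k.
  have [E0 [E1 [b0 b1 e']]] := hY k.
  exists (c *: D0 + E0), (c *: D1 + E1); split; [exact: is_der_lin..|].
  have -> : (c *: X + Y) k = c *: X k + Y k by [].
  by rewrite e e' scalerDr addrACA.
exists (maxn N M) => n; rewrite geq_max => /andP[n1 n2].
have -> : (c *: X + Y) n = c *: X n + Y n by [].
by rewrite hN // hM // scaler0 addr0.
Qed.

HB.instance Definition _ :=
  GRing.isSubmodClosed.Build C (nat -> R -> nat -> R) derSum_pred derSum_submod.

Record Der := MkDer {
  der_val :> nat -> R -> nat -> R;
  der_valP : der_val \in derSum_pred
}.

HB.instance Definition _ := [isSub for der_val].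
HB.instance Definition _ := [Choice of Der by <:].
HB.instance Definition _ := [SubChoice_isSubLmodule of Der by <:].

Definition der_gr (theta : bool) (X : Der) : Prop :=
  forall k, is_der k theta (X k).

(* Coefficient of lambda^i mu^j in D_lambda(D'_(mu-lambda) a)
   - (-1)^(|D||D'|) D'_(mu-lambda)(D_lambda a), for |D| = p and |D'| = q. *)
Definition der_comm (p q : bool) D D' (i : nat) (a : R) (j : nat) : R :=
  subst_add (-1) (fun n m => D (D' a m) n) i j
  - (-1) ^+ (p && q) *: subst_add (-1) (fun n m => D' (D a n) m) i j.

(* brD extends the bracket of derivations bilinearly, that of Der_(al^k)(R) and
   Der_(al^l)(R) being placed in the summand Der_(al^(k+l))(R). *)
Definition extends_der_comm (brD : Der -> Der -> nat -> Der) : Prop :=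
  forall p q (X Y : Der), der_gr p X -> der_gr q Y ->
  forall i m a j, brD X Y i m a j =
    \sum_(k < m.+1) der_comm p q (X k) (Y (m - k)%N) i a j.

(* D |-> D o al sends Der_(al^k)(R) to Der_(al^(k+1))(R). *)
Definition extends_comp_al (alD : Der -> Der) : Prop :=
  forall X a j, alD X 0%N a j = 0 /\
    forall k, alD X k.+1 a j = X k (al a) j.

(* (d D)_lambda = - lambda D_lambda in each summand. *)
Definition acts_by_neg_lambda (dD : Der -> Der) : Prop :=
  forall X k a j, dD X k a j = - mulX (X k a) j.

(* For R not finitely generated over C[d], the degree in lambda of
   [D_lambda D']_mu(a) may be unbounded as a varies, so that [D_lambda D'] lies
   in Der(R)[[lambda]] and not in Der(R)[lambda]. For given a it is still a
   polynomial, and skew-symmetry makes sense after evaluation at a. *)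
Definition pointwise_poly (brD : Der -> Der -> nat -> Der) : Prop :=
  forall (X Y : Der) k a, exists N, forall n, (N <= n)%N -> brD X Y n k a = 0.

Definition pointwise_skew (dD : Der -> Der) (brD : Der -> Der -> nat -> Der) :=
  forall p q (X Y : Der) k a N, der_gr p X -> der_gr q Y ->
    (forall n, (N <= n)%N -> brD Y X n k a = 0) ->
    forall n, brD X Y n k a =
      (- ((-1) ^+ (p && q) *: subst_opp dD (brD Y X) N n) : Der) k a.

End Derivations.

(* Main.v *)
From HB Require Import structures.
From mathcomp Require Import all_boot all_order all_algebra.
From mathcomp Require Import boolp functions reals complex ring.

Set Implicit Arguments.
Unset Strict Implicit.
Unset Printing Implicit Defensive.

Import GRing.Theory.
Require Import Defs.
Local Open Scope ring_scope.

(* A finitely supported array of coefficients in V is determined by the values of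
   the corresponding V-valued polynomial at all points of the infinite field C.
   Conformal derivations thus become families of honest linear maps D_z of R, the
   Leibniz rule reads
     D_z [a_w b] = [(D_z a)_(w+z) al^k b] + (-1)^(|a||D|) [(al^k a)_w (D_z b)],
   and the bracket becomes D_z D'_(w-z) - (-1)^(|D||D'|) D'_(w-z) D_z, so that its
   Leibniz rule, the Jacobi identity and the skew-symmetry are identities between
   commutators. In Der(R) the degree k is evaluated as well, at a scalar t: then
   alpha' is D |-> t D al. For R finitely generated, the lambda-degree of
   [D_lambda D'] is bounded by its maximum over the generators, since
   [D_lambda D']_mu d = (d + mu) [D_lambda D']_mu. *)

(** On coefficients, the substitutions mu - lambda and lambda + mu are convolutions with binomial
    coefficients, and the Jacobi identity nests several of them; on values they only shift
    arguments. The obstacle is that the degree of D_lambda(a) depends on a, so a derivation is not a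
    polynomial with coefficients in End(R). Evaluation is therefore made vector by vector, with a
    support that may depend on a; the values are still linear in a because coefficients determine
    values. The same finiteness at each a survives in the bracket of Der(R), where a bound uniform
    in a may fail. The sign of the commutator depends on the parities, so the bracket is constructed
    on homogeneous pairs and extended through the projections on the even and odd parts. *)

Definition lin (C : pzRingType) (V W : lmodType C) (f : V -> W) : Prop :=
  forall c a b, f (c *: a + b) = c *: f a + f b.

Section Lin.
Variables (C : pzRingType) (V W : lmodType C) (f : V -> W).
Hypothesis hf : lin f.

Lemma lin0 : f 0 = 0.
Proof. by have := hf (-1) 0 0; rewrite scaler0 addr0 scaleN1r addNr. Qed.

Lemma linZ c a : f (c *: a) = c *: f a.
Proof. by rewrite -[in LHS](addr0 (c *: a)) hf lin0 addr0. Qed.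

Lemma linD a b : f (a + b) = f a + f b.
Proof. by rewrite -[in LHS](scale1r a) hf scale1r. Qed.

Lemma linB a b : f (a - b) = f a - f b.
Proof. by rewrite -!scaleN1r linD linZ. Qed.

Lemma lin_sum (I : Type) (s : seq I) (P : pred I) (F : I -> V) :
  f (\sum_(i <- s | P i) F i) = \sum_(i <- s | P i) f (F i).
Proof. by apply: (big_morph f linD lin0). Qed.

End Lin.

(** * Finitely supported arrays and the polynomial functions they define *)

Section Arrays.
Variable C : fieldType.

Section Rep.
Variables (I : eqType) (P : Type) (m : I -> P -> C) (V : lmodType C).
Implicit Types (x y : I -> V) (F G : P -> V) (s : seq I).

(* The array x has finite support, and F is the function
   p |-> \sum_i (m i p) x_i; here m i is the monomial with exponent i. *)
Definition rep x F : Prop := exists s,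
  [/\ uniq s, forall i, i \notin s -> x i = 0
    & forall p, F p = \sum_(i <- s) m i p *: x i].

Lemma sum_widen s s' (f : I -> V) : uniq s -> uniq s' -> {subset s <= s'} ->
  (forall i, i \notin s -> f i = 0) -> \sum_(i <- s') f i = \sum_(i <- s) f i.
Proof.
move=> us us' ss' f0; rewrite (bigID (mem s)) /= [X in _ + X]big1 ?addr0 //.
rewrite -big_filter; apply: perm_big; apply: uniq_perm; rewrite ?filter_uniq //.
by move=> i; rewrite mem_filter; case: (boolP (i \in s)) => //= /ss' ->.
Qed.

(** A finite sum does not change when its index set grows. Allowing every duplicate-free superset
    lets two arrays be summed over one common set. *)
Lemma rep_widen x F : rep x F -> exists s, forall s', uniq s' -> {subset s <= s'} ->
  (forall i, i \notin s' -> x i = 0) /\ forall p, F p = \sum_(i <- s') m i p *: x i.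
Proof.
move=> [s [us x0 hF]]; exists s => s' us' ss'; split.
  by move=> i ni; apply: x0; apply: contra ni => /ss'.
move=> p; rewrite hF; apply/esym/sum_widen => // i /x0 ->; exact: scaler0.
Qed.

Lemma rep_common_support (V' : lmodType C) x F (y : I -> V') (G : P -> V') : rep x F ->
    (exists s, forall s', uniq s' -> {subset s <= s'} ->
  (forall i, i \notin s' -> y i = 0) /\ forall p, G p = \sum_(i <- s') m i p *: y i) ->
  exists s, [/\ uniq s, (forall i, i \notin s -> x i = 0),
    (forall i, i \notin s -> y i = 0),
    (forall p, F p = \sum_(i <- s) m i p *: x i)
    & forall p, G p = \sum_(i <- s) m i p *: y i].
Proof.
move=> /rep_widen[s hs] [s' hs']; exists (undup (s ++ s')).
have [|h1 h2] := hs _ (undup_uniq (s ++ s')).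
  by move=> i si; rewrite mem_undup mem_cat si.
have [|h3 h4] := hs' _ (undup_uniq (s ++ s')).
  by move=> i si; rewrite mem_undup mem_cat si orbT.
by split=> //; exact: undup_uniq.
Qed.

(** Carries identities from coefficients to values; [rep_inj] carries them back. *)
Lemma rep_fun x F G : rep x F -> rep x G -> forall p, F p = G p.
Proof.
move=> hF /rep_widen hG p; have [s [_ _ _ h1 h2]] := rep_common_support hF hG.
by rewrite h1 h2.
Qed.

Lemma rep_ext x y F G : (forall i, x i = y i) -> (forall p, F p = G p) ->
  rep x F -> rep y G.
Proof.
move=> /funext -> e [s [us h1 h2]]; exists s; split=> // p; rewrite -e; exact: h2.
Qed.

Lemma rep0 : rep (fun=> 0) (fun=> 0).
Proof. by exists [::]; split=> // p; rewrite big_nil. Qed.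

Lemma repP c x y F G : rep x F -> rep y G ->
  rep (fun i => c *: x i + y i) (fun p => c *: F p + G p).
Proof.
move=> hF /rep_widen hG; have [s [us h1 h2 h3 h4]] := rep_common_support hF hG.
exists s; split=> // [i si|p]; first by rewrite h1 // h2 // scaler0 addr0.
rewrite h3 h4 scaler_sumr -big_split /=; apply: eq_bigr => i _.
by rewrite scalerDr !scalerA mulrC.
Qed.

Lemma repD x y F G : rep x F -> rep y G ->
  rep (fun i => x i + y i) (fun p => F p + G p).
Proof.
move=> hx hy; apply: rep_ext (repP 1 hx hy) => i; by rewrite scale1r.
Qed.

Lemma repZ c x F : rep x F -> rep (fun i => c *: x i) (fun p => c *: F p).
Proof. by move=> hx; apply: rep_ext (repP c hx rep0) => i; rewrite addr0. Qed.

Lemma repB x y F G : rep x F -> rep y G ->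
  rep (fun i => x i - y i) (fun p => F p - G p).
Proof.
move=> hx hy; apply: rep_ext (repP (-1) hy hx) => i; by rewrite scaleN1r addrC.
Qed.

Lemma rep_sum (K : Type) (r : seq K) (x : K -> I -> V) (F : K -> P -> V) :
  (forall k, rep (x k) (F k)) ->
  rep (fun i => \sum_(k <- r) x k i) (fun p => \sum_(k <- r) F k p).
Proof.
move=> h; elim: r => [|k r ih].
  by apply: rep_ext rep0 => i; rewrite big_nil.
by apply: rep_ext (repD (h k) ih) => i; rewrite big_cons.
Qed.

Definition delta (i : I) (v : V) (j : I) : V := if j == i then v else 0.

Lemma rep_delta i v : rep (delta i v) (fun p => m i p *: v).
Proof.
exists [:: i]; split=> // [j|p]; last by rewrite big_seq1 /delta eqxx.
by rewrite mem_seq1 /delta => /negPf ->.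
Qed.

Lemma sum_delta s x i : uniq s -> (forall i, i \notin s -> x i = 0) ->
  x i = \sum_(j <- s) delta j (x j) i.
Proof.
move=> us x0; case: (boolP (i \in s)) => si.
  rewrite (bigD1_seq i) //= /delta eqxx big1 ?addr0 // => j.
  by rewrite eq_sym => /negPf ->.
rewrite x0 // big_seq big1 // => j sj; rewrite /delta.
by case: eqP => // e; rewrite e sj in si.
Qed.

(** Values are linear combinations of coefficients, so they stay in any subspace that contains
    these. It gives the parity of evaluated derivations. *)
Lemma rep_val (Q : V -> Prop) x F : Q 0 -> (forall c a b, Q a -> Q b -> Q (c *: a + b)) ->
  rep x F -> (forall i, Q (x i)) -> forall p, Q (F p).
Proof.
move=> Q0 QP [s [_ _ h]] hx p; rewrite h; elim: s {h} => [|i s ih].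
  by rewrite big_nil.
by rewrite big_cons; apply: QP.
Qed.

End Rep.

(** * Linear maps, changes of variables, composition of families, and recovery of coefficients *)

Section Operations.
Variables (I J : eqType) (P Q : Type) (mI : I -> P -> C) (mJ : J -> Q -> C).
Variables (V W : lmodType C).

Lemma rep_map (f : V -> W) x F : lin f -> rep mI x F -> rep mI (f \o x) (f \o F).
Proof.
move=> hf [s [us x0 h]]; exists s; split=> // [i /x0 /= ->|p /=]; first exact: lin0.
by rewrite h lin_sum //; apply: eq_bigr => i _; rewrite linZ.
Qed.

(* Substitutions: S is the effect on coefficients of the change of variables g. *)
Lemma rep_push (S : (I -> V) -> J -> V) (g : Q -> P) x F :
  (forall a b j, S (fun i => a i + b i) j = S a j + S b j) ->
  (forall j, S (fun=> 0) j = 0) ->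
  (forall i v, rep mJ (S (delta i v)) (fun q => mI i (g q) *: v)) ->
  rep mI x F -> rep mJ (S x) (F \o g).
Proof.
move=> SD S0 Sd [s [us x0 h]].
apply: (@rep_ext _ _ _ _ (fun j => \sum_(i <- s) S (delta i (x i)) j) _
  (fun q => \sum_(i <- s) mI i (g q) *: x i)); last 1 first.
- exact: rep_sum.
- move=> j; have {2}-> : x = fun i => \sum_(k <- s) delta k (x k) i.
    by apply/funext => i; apply: sum_delta.
  elim: s {us x0 h} => [|i s ih].
    rewrite big_nil (_ : (fun _ => _) = fun=> 0) ?S0 //.
    by apply/funext => i; rewrite big_nil.
  rewrite big_cons ih -SD; congr (S _ j).
  by apply/funext => k; rewrite big_cons.
by move=> q; rewrite /= h.
Qed.

Definition mprod (i : I * J) (p : P * Q) : C := mI i.1 p.1 * mJ i.2 p.2.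

Lemma rep_tensor i (y : J -> W) G : rep mJ y G ->
  rep mprod (fun ij => delta i (y ij.2) ij.1) (fun pq => mI i pq.1 *: G pq.2).
Proof.
move=> [r [ur y0 hr]]; exists [seq (i, j) | j <- r]; split.
- by rewrite map_inj_uniq // => j k [].
- move=> [i' j] /= ni; rewrite /delta; case: eqP => // e.
  by apply: y0; apply: contra ni; rewrite e => rj; apply: map_f.
move=> [p q] /=; rewrite hr big_map /= scaler_sumr; apply: eq_bigr => j _.
by rewrite /delta eqxx scalerA.
Qed.

(** The support of [A v] may depend on [v], but only the finitely many vectors [x i] with [i] in the
    support of [x] occur, since [A] vanishes at 0. The array is thus a finite sum of arrays as in
    [rep_tensor]. *)
Lemma rep_bind (A : V -> J -> W) (Av : V -> Q -> W) x F :
  (forall j, lin (A^~ j)) -> (forall v, rep mJ (A v) (Av v)) -> rep mI x F ->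
  rep mprod (fun ij => A (x ij.1) ij.2) (fun pq => Av (F pq.1) pq.2).
Proof.
move=> Alin hA [s [us x0 h]].
have Avlin q : lin (Av^~ q).
  move=> c a b; have e := rep_ext (fun j => esym (Alin j c a b)) (fun=> erefl)
    (repP c (hA a) (hA b)).
  exact: rep_fun (hA _) e q.
apply: (@rep_ext _ _ _ _ (fun ij => \sum_(i <- s) delta i (A (x i) ij.2) ij.1) _
  (fun pq => \sum_(i <- s) mI i pq.1 *: Av (x i) pq.2)); last 1 first.
- by apply: rep_sum => i; exact: rep_tensor.
- move=> [i j] /=; case: (boolP (i \in s)) => si.
    rewrite (bigD1_seq i) //= /delta eqxx big1 ?addr0 // => k.
    by rewrite eq_sym => /negPf ->.
  rewrite x0 // (lin0 (Alin j)) big_seq big1 // => k sk; rewrite /delta.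
  by case: eqP => // e; rewrite e sk in si.
move=> [p q] /=; rewrite h (lin_sum (Avlin q)); apply: eq_bigr => i _.
by rewrite (linZ (Avlin q)).
Qed.

(** Permutes and regroups variables. The inverse [f'] is needed because the array concentrated at
    [i] is moved to [f' i]. *)
Lemma rep_reindex (f : J -> I) (f' : I -> J) (g : Q -> P) x F :
  cancel f f' -> cancel f' f -> (forall i q, mI i (g q) = mJ (f' i) q) ->
  rep mI (x : I -> V) F -> rep mJ (x \o f) (F \o g).
Proof.
move=> ff' f'f hm; apply: (@rep_push (fun x => x \o f)) => // i v.
apply: rep_ext (rep_delta mJ (f' i) v) => [j|q /=]; last by rewrite hm.
by rewrite /delta /= -(can_eq f'f) ff'.
Qed.

(** Linear independence of the monomials as functions, with coefficients in an arbitrary vector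
    space. *)
Definition separating (I' : eqType) (P' : Type) (m : I' -> P' -> C) : Prop :=
  forall (V : lmodType C) (x : I' -> V), rep m x (fun=> 0) -> forall i, x i = 0.

(** With the second variable fixed at [q], the partial sums over [j] form an array in [i] with zero
    values, hence are 0; letting [q] vary then isolates each coefficient. *)
Lemma separating_prod : separating mI -> separating mJ -> separating mprod.
Proof.
move=> sI sJ U x [s [us x0 h]].
pose s1 := undup (unzip1 s); pose s2 := undup (unzip2 s).
have s12 i j : (i, j) \in s -> (i \in s1) && (j \in s2).
  move=> sij; rewrite !mem_undup; apply/andP; split.
    exact: (map_f fst sij).
  exact: (map_f snd sij).
have y0 q i : \sum_(j <- s2) mJ j q *: x (i, j) = 0.
  apply: (sI _ (fun i => \sum_(j <- s2) mJ j q *: x (i, j))); exists s1.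
  split; first exact: undup_uniq.
    move=> k nk; rewrite big1 // => j _; rewrite x0 ?scaler0 //.
    by apply: contra nk => /s12 /andP[].
  move=> p; rewrite [LHS](h (p, q)).
  have <- : \sum_(ij <- [seq (i, j) | i <- s1, j <- s2])
      mprod ij (p, q) *: x ij = \sum_(i0 <- s) mprod i0 (p, q) *: x i0.
    apply: sum_widen => //.
    - by apply: allpairs_uniq; rewrite ?undup_uniq // => -[? ?] [].
    - by move=> [k l] /s12 /andP[? ?]; apply/allpairsP; exists (k, l).
    by move=> k /x0 ->; rewrite scaler0.
  rewrite big_allpairs; apply: eq_bigr => k _.
  by rewrite scaler_sumr; apply: eq_bigr => l _; rewrite scalerA.
move=> [i j]; apply: (sJ _ (fun j => x (i, j))); exists s2.
split=> //; first exact: undup_uniq.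
move=> k nk; apply: x0; by apply: contra nk => /s12 /andP[].
Qed.

End Operations.

Lemma rep_inj (I : eqType) P (m : I -> P -> C) (V : lmodType C) (x y : I -> V) F G :
  separating m -> rep m x F -> rep m y G -> (forall p, F p = G p) ->
  forall i, x i = y i.
Proof.
move=> sm hx hy e i; apply/eqP; rewrite -subr_eq0; apply/eqP.
apply: (sm _ (fun i => x i - y i)); apply: rep_ext (repB hx hy) => // p.
by rewrite e subrr.
Qed.

Definition mX (n : nat) (z : C) : C := z ^+ n.
(* The monomials without variables, indexing single operators as families. *)
Definition m1 (n : unit) (z : unit) : C := 1.

Lemma separating1 : separating m1.
Proof.
move=> V x [s [us x0 h]] [].
case: (boolP (tt \in s)) => [|/x0 //] si; have := h tt.
rewrite (bigD1_seq tt) //= scale1r big1 ?addr0 // => -[]; by rewrite eqxx.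
Qed.

Lemma separatingX : injective (fun n => n%:R : C) -> separating mX.
Proof.
move=> inj V x [s [us x0 h]] i.
have [N hN] : exists N, forall n, n \in s -> (n < N)%N.
  by exists (\max_(n <- s) n).+1 => n sn; rewrite ltnS; apply: leq_bigmax_seq.
case: (ltnP i N) => iN; last first.
  by apply: x0; apply/negP => /hN; rewrite ltnNge iN.
(* The points 0, ..., N-1 are distinct in [C], so their Vandermonde matrix is invertible, and column
   [i] of its inverse expresses [x i] through the values at these points. *)
pose a : 'rV[C]_N := \row_j j%:R.
have hz z : \sum_(n < N) z ^+ n *: x n = 0.
  rewrite [RHS](h z) -(big_mkord xpredT (fun n => z ^+ n *: x n)).
  apply: sum_widen => //; first exact: iota_uniq.
    by move=> n /hN nN; rewrite mem_index_iota.
  by move=> n /x0 ->; rewrite scaler0.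
have : Vandermonde N a \in unitmx.
  rewrite unitmxE det_Vandermonde unitfE; apply/prodf_neq0 => j _.
  apply/prodf_neq0 => k jk; rewrite !mxE subr_eq0.
  by apply/eqP => /inj /esym e; rewrite e ltnn in jk.
move=> /mulmxV e.
have : x i = \sum_(n < N) (n == Ordinal iN)%:R *: x n.
  rewrite (bigD1 (Ordinal iN)) //= eqxx scale1r big1 ?addr0 // => n /negPf ->.
  by rewrite scale0r.
have e' (n : 'I_N) : (n == Ordinal iN)%:R =
    \sum_(j < N) (j%:R : C) ^+ n * invmx (Vandermonde N a) j (Ordinal iN).
  have := congr1 (fun M : 'M_N => M n (Ordinal iN)) e.
  rewrite !mxE => <-; apply: eq_bigr => j _; by rewrite !mxE.
move=> ->; under eq_bigr do rewrite e' scaler_suml.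
rewrite exchange_big big1 //= => j _.
under eq_bigr do rewrite mulrC -scalerA.
by rewrite -scaler_sumr hz scaler0.
Qed.

Lemma fin_supp_rep (V : lmodType C) (x : nat -> V) :
  fin_supp x -> exists F, rep mX x F.
Proof.
move=> [N hN]; exists (fun z => \sum_(n <- iota 0 N) z ^+ n *: x n), (iota 0 N).
split=> //; first exact: iota_uniq.
by move=> i; rewrite mem_iota /= add0n -leqNgt => /hN.
Qed.

(** When [f] selects one exponent of a multi-index, the joint finite support bounds this exponent
    uniformly in all the others. *)
Lemma rep_fin_supp (I : eqType) P (m : I -> P -> C) (V : lmodType C) (x : I -> V) F
  (f : I -> nat) : rep m x F -> exists N, forall i, (N <= f i)%N -> x i = 0.
Proof.
move=> [s [_ h _]]; exists (\max_(i <- s) f i).+1 => i iN; apply: h.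
by apply: contraTN iN => si; rewrite -ltnNge ltnS; apply: leq_bigmax_seq.
Qed.

End Arrays.

(** * The coefficient formulas as substitutions of variables *)

Section Substitutions.
Variables (C : fieldType) (L L' J : eqType) (P P' Q : Type).
Variables (mL : L -> P -> C) (mL' : L' -> P' -> C) (mJ : J -> Q -> C).
Variable V : lmodType C.
Local Notation mX := (@mX C).

(** The binomial expansion of lambda^n0 (mu + s lambda)^m0. *)
Lemma subst_add_delta (s : C) (v : V) n0 m0 i j :
  subst_add s (fun n m => delta (n0, m0) v (n, m)) i j =
  \sum_(t < m0.+1) delta ((n0 + t)%N, (m0 - t)%N) ((s ^+ t * 'C(m0, t)%:R) *: v) (i, j).
Proof.
pose f t : V := if (i == n0 + t)%N && (m0 == j + t)%N
  then (s ^+ t * 'C(m0, t)%:R) *: v else 0.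
(* The two sides let [t] run up to [i] and up to [m0]; both are compared with a range that contains
   them, on which the additional terms vanish. *)
transitivity (\sum_(0 <= t < (i + m0).+1) f t).
  rewrite (big_cat_nat (n := i.+1)) //= ?ltnS ?leq_addr // [X in _ + X]big1_seq.
    rewrite addr0 big_mkord; apply: eq_bigr => t _; rewrite /f /delta xpair_eqE.
    have ti : (t <= i)%N by rewrite -ltnS.
    rewrite -(eqn_add2r t) subnK // [(j + t == m0)%N]eq_sym.
    case: ifP => [/andP[_ /eqP ->]|_]; last exact: scaler0.
    by rewrite -[in RHS]bin_sub ?leq_addl // addnK.
  move=> t; rewrite mem_index_iota /f => /andP[_ /andP[it _]].
  by case: eqP => //= e; rewrite e ltnNge leq_addl in it.
rewrite (big_cat_nat (n := m0.+1)) //= ?ltnS ?leq_addl // [X in _ + X]big1_seq.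
  rewrite addr0 big_mkord; apply: eq_bigr => t _; rewrite /f /delta xpair_eqE.
  have ti : (t <= m0)%N by rewrite -ltnS.
  by rewrite -[(j == _)%N](eqn_add2r t) subnK // [(j + t == m0)%N]eq_sym.
move=> t; rewrite mem_index_iota /f => /andP[_ /andP[it _]].
by rewrite andbC; case: eqP => //= e; rewrite e ltnNge leq_addl in it.
Qed.

Lemma subst_addD (s : C) (x y : nat -> nat -> V) i j :
  subst_add s (fun n m => x n m + y n m) i j = subst_add s x i j + subst_add s y i j.
Proof. by rewrite -big_split /=; apply: eq_bigr => t _; rewrite scalerDr. Qed.

Lemma subst_add0 (s : C) (x : nat -> nat -> V) i j :
  (forall n m, x n m = 0) -> subst_add s x i j = 0.
Proof. by move=> x0; apply: big1 => t _; rewrite x0 scaler0. Qed.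

(** On values, [subst_add] replaces mu by mu + s lambda; by additivity a single monomial suffices.
    The index [L] carries the variables that do not take part. *)
Lemma rep_subst_add (s : C) (x : L * (nat * nat) -> V) F :
  rep (mprod mL (mprod mX mX)) x F ->
  rep (mprod mL (mprod mX mX))
    (fun k => subst_add s (fun n m => x (k.1, (n, m))) k.2.1 k.2.2)
    (fun p => F (p.1, (p.2.1, p.2.2 + s * p.2.1))).
Proof.
apply: (rep_push (g := fun p => (p.1, (p.2.1, p.2.2 + s * p.2.1)))
  (S := fun x k => subst_add s (fun n m => x (k.1, (n, m))) k.2.1 k.2.2)).
- by move=> a b j; exact: subst_addD.
- by move=> j; exact: subst_add0.
move=> [l [n0 m0]] v.
apply: (@rep_ext _ _ _ _ _ (fun k => \sum_(t < m0.+1)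
    delta (l, ((n0 + t)%N, (m0 - t)%N)) ((s ^+ t * 'C(m0, t)%:R) *: v) k) _
  _ _ _ _ (rep_sum _ (fun t : 'I_m0.+1 => rep_delta _ _ _))).
  move=> [l' [i j]] /=; rewrite /delta.
  case: (eqVneq l' l) => [->|ne].
    under eq_bigr do rewrite xpair_eqE eqxx /=.
    rewrite -subst_add_delta; apply: eq_bigr => t _.
    by rewrite /delta !xpair_eqE eqxx.
  rewrite big1 => [|t _]; last by rewrite xpair_eqE (negPf ne).
  by rewrite subst_add0 // => n m; rewrite xpair_eqE (negPf ne).
move=> [p [z w]] /=; rewrite /mprod /mX /= exprDn mulrA mulr_sumr scaler_suml.
apply: eq_bigr => t _; rewrite scalerA; congr (_ *: _).
by rewrite exprD exprMn -mulr_natr; ring.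
Qed.

(* Multiplication of the generating functions in the degree indices k and k'. *)
Lemma rep_conv (x : (L * nat) * (L' * nat) * J -> V) F :
  rep (mprod (mprod (mprod mL mX) (mprod mL' mX)) mJ) x F ->
  rep (mprod (mprod (mprod mL mL') mX) mJ)
    (fun i => \sum_(k < i.1.2.+1)
       x ((i.1.1.1, k : nat), (i.1.1.2, (i.1.2 - k)%N), i.2))
    (fun p => F ((p.1.1.1, p.1.2), (p.1.1.2, p.1.2), p.2)).
Proof.
apply: (rep_push (g := fun p => ((p.1.1.1, p.1.2), (p.1.1.2, p.1.2), p.2))
  (S := fun x i => \sum_(k < i.1.2.+1)
       x ((i.1.1.1, k : nat), (i.1.1.2, (i.1.2 - k)%N), i.2))).
- by move=> a b j; rewrite -big_split.
- by move=> j; rewrite big1.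
move=> [[[l k0] [l' k1]] j0] v.
apply: rep_ext (rep_delta _ ((l, l', k0 + k1)%N, j0) v).
  move=> [[[i i'] M] j] /=; rewrite /delta !xpair_eqE.
  under eq_bigr do rewrite !xpair_eqE.
  case: (eqVneq i l) => _ /=; last by rewrite big1.
  case: (eqVneq i' l') => _ /=; last by rewrite big1 // => k _; rewrite andbF.
  case: (eqVneq j j0) => _ /=; last by rewrite andbF big1 // => k _; rewrite andbF.
  rewrite andbT; under eq_bigr do rewrite andbT.
  case: eqP => [->|ne].
    rewrite (bigD1 (Ordinal (leq_addr k1 k0 : k0 < (k0 + k1).+1)%N)) //= eqxx addKn eqxx.
    rewrite big1 ?addr0 // => k kn; case: eqP => //= e; case/eqP: kn.
    exact: val_inj.
  rewrite big1 // => k _; case: eqP => //= e; case: eqP => //= e'; case: ne.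
  by rewrite -e -e' subnKC // -ltnS.
move=> [[[p p'] t] q] /=; rewrite /mprod /mX /= exprD; congr (_ *: _); ring.
Qed.

Lemma rep_sign (x : nat * J -> V) F : rep (mprod mX mJ) x F ->
  rep (mprod mX mJ) (fun i => (-1) ^+ i.1 *: x i) (fun p => F (- p.1, p.2)).
Proof.
apply: (rep_push (g := fun p => (- p.1, p.2)) (S := fun x i => (-1) ^+ i.1 *: x i)).
- by move=> a b j; rewrite scalerDr.
- by move=> j; rewrite scaler0.
move=> [n j] v; apply: rep_ext (repZ ((-1) ^+ n) (rep_delta _ (n, j) v)).
  by move=> i; rewrite /delta; case: eqP => [->|_] //; rewrite !scaler0.
move=> [z q] /=; rewrite scalerA /mprod /mX /= [(- z) ^+ n]exprNn; congr (_ *: _); ring.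
Qed.

End Substitutions.

Lemma subst_add_mulXl (C : fieldType) (V : lmodType C) (s : C) (x : nat -> nat -> V) i j :
  subst_add s (fun n m => mulX (x^~ m) n) i j = mulX (fun n => subst_add s x n j) i.
Proof.
case: i => [|i]; rewrite /subst_add.
  by rewrite big_ord1 /= scaler0.
rewrite big_ord_recr /= subnn /= scaler0 addr0; apply: eq_bigr => t _.
by rewrite subSn // -ltnS.
Qed.

(** The factor mu becomes mu + s lambda; on coefficients this is Pascal's rule. *)
Lemma subst_add_mulXr (C : fieldType) (V : lmodType C) (s : C) (x : nat -> nat -> V) i j :
  subst_add s (fun n m => mulX (x n) m) i j =
  mulX (subst_add s x i) j + s *: mulX (fun n => subst_add s x n j) i.
Proof.
case: j => [|j]; rewrite /subst_add.
  rewrite add0r big_ord_recl /= scaler0 add0r; case: i => [|i].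
    by rewrite big_ord0 scaler0.
  rewrite scaler_sumr; apply: eq_bigr => t _ /=.
  by rewrite !bin0 scalerA exprS mulrA subSS.
have E (t : 'I_i.+1) : (s ^+ t * 'C(j.+1 + t, j.+1)%:R) *: mulX (x (i - t)%N) (j.+1 + t) =
   (s ^+ t * 'C(j + t, j)%:R) *: x (i - t)%N (j + t)%N +
   (s ^+ t * 'C(j + t, j.+1)%:R) *: x (i - t)%N (j + t)%N.
  by rewrite addSn binS natrD mulrDr addrC scalerDl.
rewrite (eq_bigr _ (fun t _ => E t)) big_split /=; congr (_ + _).
rewrite big_ord_recl /= addn0 bin_small // mulr0 scale0r add0r.
case: i E => [|i] _; first by rewrite big_ord0 scaler0.
rewrite scaler_sumr; apply: eq_bigr => t _ /=.
by rewrite scalerA exprS mulrA subSS /bump /= add1n addnS addSn.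
Qed.

(** * Polynomial families of linear maps and the evaluated Leibniz rule *)

Section Operators.
Variable C : fieldType.
Hypothesis natC_inj : injective (fun n => n%:R : C).
Variable R : homLieConfSuper C.
Local Notation br := (@hlcs_br C R).
Local Notation mX := (@mX C).
Local Notation m1 := (@m1 C).

(** A family of linear maps with its values, where the support is finite at each vector but may
    depend on the vector. *)
Definition polyop (I : eqType) (P : Type) (m : I -> P -> C)
    (A : I -> R -> R) (Av : P -> R -> R) : Prop :=
  (forall i, lin (A i)) /\ forall a, rep m (A^~ a) (Av^~ a).

Lemma polyop_lin I P m A Av : @polyop I P m A Av -> forall p, lin (Av p).
Proof.
move=> [hl hA] p c a b; have e := rep_ext (fun j => esym (hl j c a b)) (fun=> erefl)
  (repP c (hA a) (hA b)).
exact: rep_fun (hA _) e p.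
Qed.

Lemma polyop_comp I P m A Av J Q m' B Bv :
  @polyop I P m A Av -> @polyop J Q m' B Bv ->
  forall a, rep (mprod m m') (fun i => A i.1 (B i.2 a)) (fun p => Av p.1 (Bv p.2 a)).
Proof.
move=> [lA hA] [lB hB] a.
have h := rep_bind (A := fun v i => A i v) (Av := fun v p => Av p v) lA hA (hB a).
apply: (rep_reindex (f := fun i => (i.2, i.1)) (f' := fun i => (i.2, i.1))
  (g := fun i => (i.2, i.1)) (mJ := mprod m m') _ _ _ h); try by case.
by move=> [i j] [p q]; rewrite /mprod mulrC.
Qed.

(** In both products the first variable belongs to [A] and the second to [B], so the composite in
    the opposite order is rearranged before mu is replaced by mu - lambda. The indices [I] and [J]
    hold further parameters, such as the degree in Der(R). *)
Lemma polyop_comm I P m A Av J Q m' B Bv p q :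
  @polyop _ _ (@mprod C I nat P C m mX) A Av ->
  @polyop _ _ (@mprod C J nat Q C m' mX) B Bv -> forall a,
  rep (mprod (mprod m m') (mprod mX mX))
    (fun i => der_comm p q (fun a n => A (i.1.1, n) a) (fun a n => B (i.1.2, n) a)
       i.2.1 a i.2.2)
    (fun r => Av (r.1.1, r.2.1) (Bv (r.1.2, r.2.2 - r.2.1) a)
      - (-1) ^+ (p && q) *: Bv (r.1.2, r.2.2 - r.2.1) (Av (r.1.1, r.2.1) a)).
Proof.
move=> hA hB a; apply: repB; last apply: repZ.
- have h := polyop_comp hA hB a.
  have {}h := rep_reindex (f := fun i : (I * J) * (nat * nat) => ((i.1.1, i.2.1), (i.1.2, i.2.2)))
    (f' := fun i => ((i.1.1, i.2.1), (i.1.2, i.2.2)))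
    (g := fun i : (P * Q) * (C * C) => ((i.1.1, i.2.1), (i.1.2, i.2.2)))
    (mJ := mprod (mprod m m') (mprod mX mX)) _ _ _ h.
  apply: rep_ext (rep_subst_add (-1) (h _ _ _)) => //.
  + by move=> r; rewrite mulN1r.
  + by move=> [[? ?] [? ?]].
  + by move=> [[? ?] [? ?]].
  by move=> [[? ?] [? ?]] [[? ?] [? ?]]; rewrite /mprod /=; ring.
have h := polyop_comp hB hA a.
have {}h := rep_reindex (f := fun i : (I * J) * (nat * nat) => ((i.1.2, i.2.2), (i.1.1, i.2.1)))
  (f' := fun i => ((i.2.1, i.1.1), (i.2.2, i.1.2)))
  (g := fun i : (P * Q) * (C * C) => ((i.1.2, i.2.2), (i.1.1, i.2.1)))
  (mJ := mprod (mprod m m') (mprod mX mX)) _ _ _ h.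
apply: rep_ext (rep_subst_add (-1) (h _ _ _)) => //.
+ by move=> r; rewrite mulN1r.
+ by move=> [[? ?] [? ?]].
+ by move=> [[? ?] [? ?]].
by move=> [[? ?] [? ?]] [[? ?] [? ?]]; rewrite /mprod /=; ring.
Qed.

Let core := hlcs_to_core (hlcs_axioms R).

Lemma br_linl b n : lin (fun a => br a b n).
Proof. by move=> c a a'; exact: core_br_linl core c a a' b n. Qed.

Lemma br_linr a n : lin (fun b => br a b n).
Proof. by move=> c b b'; exact: core_br_linr core c a b b' n. Qed.

Lemma br_eval : exists Bv : C -> R -> R -> R,
  forall a b, rep mX (br a b) (fun z => Bv z a b).
Proof.
have h (ab : R * R) := fin_supp_rep (br_poly (hlcs_axioms R) ab.1 ab.2).
have [f hf] := choice h.
by exists (fun z a b => f (a, b) z) => a b; exact: (hf (a, b)).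
Qed.

Section Evaluated.
Variable Bv : C -> R -> R -> R.
Hypothesis hB : forall a b, rep mX (br a b) (fun z => Bv z a b).

Lemma Bv_linl b z : lin (fun a => Bv z a b).
Proof. exact: (polyop_lin (conj (br_linl b) (hB^~ b)) z). Qed.

Lemma Bv_linr a z : lin (fun b => Bv z a b).
Proof. exact: (polyop_lin (conj (br_linr a) (hB a)) z). Qed.

(** Read from left to right it evaluates the Leibniz rule of given derivations; read from right to
    left it returns the coefficient form for their commutator. *)
Lemma leibniz_eval (L : eqType) P (m : L -> P -> C) A Av (a b a' b' : R) (e : C) :
  separating m -> polyop (mprod m mX) A Av ->
  (forall l i j, A (l, i) (br a b j) =
     subst_add 1 (fun n k => br (A (l, n) a) b' k) i j + e *: br a' (A (l, i) b) j)
  <-> (forall p z w, Av (p, z) (Bv w a b) =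
     Bv (w + z) (Av (p, z) a) b' + e *: Bv w a' (Av (p, z) b)).
Proof.
move=> sm [lA hA].
pose M := mprod m (mprod mX mX).
have h1 : rep M (fun i => A (i.1, i.2.1) (br a b i.2.2))
    (fun p => Av (p.1, p.2.1) (Bv p.2.2 a b)).
  have h := rep_bind (A := fun v i => A i v) (Av := fun v p => Av p v) lA hA (hB a b).
  apply: (rep_reindex (f := fun i => (i.2.2, (i.1, i.2.1)))
    (f' := fun i => (i.2.1, (i.2.2, i.1)))
    (g := fun i => (i.2.2, (i.1, i.2.1))) (mJ := M) _ _ _ h).
  - by move=> [? [? ?]].
  - by move=> [? [? ?]].
  by move=> [? [? ?]] [? [? ?]]; rewrite /M /mprod /=; ring.
have rea (x : L * nat * nat -> R) F : rep (mprod (mprod m mX) mX) x F ->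
  rep M (fun i => x ((i.1, i.2.1), i.2.2)) (fun i => F ((i.1, i.2.1), i.2.2)).
  apply: (rep_reindex (f := fun i => ((i.1, i.2.1), i.2.2))
    (f' := fun i => (i.1.1, (i.1.2, i.2))) (g := fun i => ((i.1, i.2.1), i.2.2))).
  - by move=> [? [? ?]].
  - by move=> [[? ?] ?].
  by move=> [[? ?] ?] [? [? ?]]; rewrite /M /mprod /= mulrA.
have h2 : rep M (fun i => subst_add 1 (fun n k => br (A (i.1, n) a) b' k) i.2.1 i.2.2)
    (fun p => Bv (p.2.2 + p.2.1) (Av (p.1, p.2.1) a) b').
  have h := rep_bind (A := fun v => br v b') (Av := fun v p => Bv p v b')
    (br_linl b') (fun v => hB v b') (hA a).
  by apply: rep_ext (rep_subst_add 1 (rea _ _ h)) => // r; rewrite mul1r.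
have h3 : rep M (fun i => br a' (A (i.1, i.2.1) b) i.2.2)
    (fun p => Bv p.2.2 a' (Av (p.1, p.2.1) b)).
  have h := rep_bind (A := br a') (Av := fun v p => Bv p a' v)
    (br_linr a') (hB a') (hA b).
  exact: rea _ _ h.
have h4 := repD h2 (repZ e h3); split=> H.
  move=> p z w; have h5 := rep_ext (fun i => esym (H i.1 i.2.1 i.2.2)) (fun=> erefl) h4.
  exact: rep_fun h1 h5 (p, (z, w)).
have sM : separating M by do 2?apply: separating_prod => //; exact: separatingX.
by move=> l i j; apply: (rep_inj sM h1 h4 _ (l, (i, j))) => -[p [z w]]; rewrite /= H.
Qed.

End Evaluated.

Lemma homconf_polyop theta D : is_homconf theta D ->
  exists Dv, polyop (mprod m1 mX) (fun i a => D a i.2) Dv.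
Proof.
move=> h; have [f hf] := choice (fun a => fin_supp_rep (homconf_poly h a)).
exists (fun p a => f a p.2); split; first by move=> i c a b; exact: homconf_lin h c a b _.
move=> a.
apply: (rep_reindex (f := fun i => i.2) (f' := pair tt) (g := fun i => i.2) _ _ _ (hf a)) => //.
- by case; case.
by move=> i [[] z]; rewrite /mprod mul1r.
Qed.

End Operators.

(** * The commutator of two homogeneous derivations *)

Section Commutator.
Variable C : fieldType.
Hypothesis natC_inj : injective (fun n => n%:R : C).
Variable R : homLieConfSuper C.
Local Notation d := (hlcs_d R).
Local Notation al := (hlcs_al R).
Local Notation gr := (@hlcs_gr C R).
Local Notation br := (@hlcs_br C R).
Local Notation mX := (@mX C).
Local Notation m1 := (@m1 C).

Lemma gr_lin p : gr p 0 /\ forall (c : C) a b, gr p a -> gr p b -> gr p (c *: a + b).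
Proof. by split; [exact: gr0 (gr_super R) p|exact: grP (gr_super R) p]. Qed.

Lemma gr_sumr p (I : Type) (s : seq I) (F : I -> R) :
  (forall i, gr p (F i)) -> gr p (\sum_(i <- s) F i).
Proof.
have [g0 gP] := gr_lin p; move=> h; elim: s => [|i s ih]; first by rewrite big_nil.
by rewrite big_cons -[F i]scale1r; apply: gP.
Qed.

Lemma gr_scale p (c : C) a : gr p a -> gr p (c *: a).
Proof. by have [g0 gP] := gr_lin p; move=> ga; rewrite -[_ *: a]addr0; apply: gP. Qed.

Lemma gr_subst_add p (s : C) (x : nat -> nat -> R) i j :
  (forall n m, gr p (x n m)) -> gr p (subst_add s x i j).
Proof. by move=> h; apply: gr_sumr => t; apply: gr_scale. Qed.

Lemma gr_iter_al p k a : gr p a -> gr p (iter k al a).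
Proof.
move=> ga; elim: k => //= k ih.
exact: core_al_even (hlcs_to_core (hlcs_axioms R)) _ _ ih.
Qed.

Section Evaluated.
Variables (Bv : C -> R -> R -> R) (k : nat) (theta : bool) (D : R -> nat -> R)
  (Dv : unit * C -> R -> R).
Hypothesis hB : forall a b, rep mX (br a b) (fun z => Bv z a b).
Hypothesis hD : is_der k theta D.
Hypothesis hDv : polyop (mprod m1 mX) (fun i a => D a i.2) Dv.

Lemma eval_al z a : Dv z (al a) = al (Dv z a).
Proof.
have [_ h] := hDv; have lal : lin al by move=> c u v; exact: linearP.
apply: (rep_fun (h (al a)) (rep_ext _ (fun=> erefl) (rep_map lal (h a)))) => i /=.
by rewrite (homconf_al (der_homconf hD)).
Qed.

Lemma eval_iter_al n z a : Dv z (iter n al a) = iter n al (Dv z a).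
Proof. by elim: n => //= n ih; rewrite eval_al ih. Qed.

Lemma eval_gr p z a : gr p a -> gr (p (+) theta) (Dv z a).
Proof.
move=> ga; have [_ h] := hDv; have [g0 gP] := gr_lin (p (+) theta).
apply: (rep_val g0 gP (h a)) => i; exact: homconf_gr (der_homconf hD) _ _ _ ga.
Qed.

Lemma eval_leibniz p z w a b : gr p a ->
  Dv z (Bv w a b) = Bv (w + z.2) (Dv z a) (iter k al b)
    + (-1) ^+ (p && theta) *: Bv w (iter k al a) (Dv z b).
Proof.
move=> ga; case: z => [t z] /=.
have [h _] := leibniz_eval natC_inj hB a b (iter k al a) (iter k al b)
  ((-1) ^+ (p && theta)) (@separating1 C) hDv.
by apply: h => l i j /=; exact: (der_leibniz hD).
Qed.
End Evaluated.

Lemma der_comm_lin p q D D' i j : (forall n, lin (D^~ n)) -> (forall n, lin (D'^~ n)) ->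
  lin (fun a => @der_comm C R p q D D' i a j).
Proof.
move=> lD lD' c a b; rewrite /der_comm.
have -> : subst_add (-1) (fun n m => D (D' (c *: a + b) m) n) i j =
    c *: subst_add (-1) (fun n m => D (D' a m) n) i j
    + subst_add (-1) (fun n m => D (D' b m) n) i j.
  by rewrite -subst_add_lin; apply: eq_bigr => t _; rewrite lD' lD.
have -> : subst_add (-1) (fun n m => D' (D (c *: a + b) n) m) i j =
    c *: subst_add (-1) (fun n m => D' (D a n) m) i j
    + subst_add (-1) (fun n m => D' (D b n) m) i j.
  by rewrite -subst_add_lin; apply: eq_bigr => t _; rewrite lD lD'.
rewrite scalerDr opprD addrACA; congr (_ + _).
by rewrite scalerBr !scalerA mulrC.
Qed.

Lemma homconf_coef_lin theta D n : @is_homconf C R theta D -> lin (D^~ n).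
Proof. by move=> h c a b; exact: homconf_lin h c a b n. Qed.

Lemma der_comm_homconf p q D D' i : is_homconf p D -> is_homconf q D' ->
  is_homconf (p (+) q) (@der_comm C R p q D D' i).
Proof.
move=> hD hD'; split.
- by move=> c a b n; apply: der_comm_lin => u;
    [exact: homconf_coef_lin hD|exact: homconf_coef_lin hD'].
- move=> a; have [Dv hDv] := homconf_polyop hD; have [Dv' hDv'] := homconf_polyop hD'.
  have [N hN] := rep_fin_supp (fun k => k.2.2) (polyop_comm p q hDv hDv' a).
  by exists N => n /(hN (tt, tt, (i, n))).
- move=> a n; rewrite /der_comm.
  have dlin : forall s (x : nat -> nat -> R) i j,
      d (subst_add s x i j) = subst_add s (fun n m => d (x n m)) i j.
    by move=> s x u v; rewrite linear_sum; apply: eq_bigr => t _; rewrite linearZ.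
  (* Moving d through both maps adds lambda + (mu - lambda) = mu: after the substitution the two
     multiplications by lambda cancel. *)
  have E (x y : nat -> nat -> R) : (forall u v, y u v =
      d (x u v) + (mulX (x^~ v) u + mulX (x u) v)) ->
      subst_add (-1) y i n = d (subst_add (-1) x i n) + mulX (subst_add (-1) x i) n.
    move=> e; rewrite (_ : y = fun u v => d (x u v) + (mulX (x^~ v) u + mulX (x u) v)).
      rewrite !subst_addD subst_add_mulXr (subst_add_mulXl (-1) x) dlin scaleN1r.
      by congr (_ + _); rewrite addrC subrK.
    by apply/funext => u; apply/funext => v.
  have mX0 D0 th (f : nat -> R) u v : is_homconf th D0 ->
      D0 (mulX f v) u = mulX (fun v => D0 (f v) u) v.
    by move=> h; case: v => //=; exact: lin0 (homconf_coef_lin u h).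
  have addD (D0 : R -> nat -> R) th u v w : is_homconf th D0 -> D0 (u + v) w = D0 u w + D0 v w.
    by move=> h; exact: linD (homconf_coef_lin w h) _ _.
  rewrite (E (fun n m => D (D' a m) n) (fun n m => D (D' (d a) m) n)); last first.
    move=> u v; rewrite (homconf_d hD') (addD _ _ _ _ _ hD) (homconf_d hD) -addrA.
    by rewrite (mX0 _ _ _ _ _ hD).
  rewrite (E (fun n m => D' (D a n) m) (fun n m => D' (D (d a) n) m)); last first.
    move=> u v; rewrite (homconf_d hD) (addD _ _ _ _ _ hD') (homconf_d hD') -addrA.
    by rewrite (mX0 _ _ _ _ _ hD') [mulX _ u + _]addrC.
  rewrite linearB [d (_ *: _)]linearZ scalerDr opprD addrACA; congr (_ + _).
  by case: n {E} => [|n] /=; rewrite ?scaler0 ?subr0.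
- move=> r a n ga; rewrite /der_comm -scaleN1r addrC; have [_ gP] := gr_lin (r (+) (p (+) q)).
  apply: gP; first apply: gr_scale; apply: gr_subst_add => u v.
    by rewrite addbA; apply: (homconf_gr hD'); apply: (homconf_gr hD).
  by rewrite [p (+) q]addbC addbA; apply: (homconf_gr hD); apply: (homconf_gr hD').
move=> a n; rewrite /der_comm linearB [al (_ *: _)]linearZ; congr (_ - _ *: _);
  rewrite linear_sum; apply: eq_bigr => t _; rewrite linearZ; congr (_ *: _).
  by rewrite (homconf_al hD') (homconf_al hD).
by rewrite (homconf_al hD) (homconf_al hD').
Qed.

(** Here [a], [b], [c], [e] stand for [DD'x, y], [D'x, Dy], [Dx, D'y], [x, DD'y] for the bracket of
    x and y, up to powers of [al], and [a'], [e'] for the outer terms of D'D. The mixed terms [b]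
    and [c] occur in both products and cancel. *)
Lemma leibniz_signs (V : lmodType C) (r p q : bool) (a b c e a' e' : V) :
  a + (-1) ^+ ((r (+) q) && p) *: b
    + (-1) ^+ (r && q) *: (c + (-1) ^+ (r && p) *: e)
    - (-1) ^+ (p && q) *: (a' + (-1) ^+ ((r (+) p) && q) *: c
      + (-1) ^+ (r && p) *: (b + (-1) ^+ (r && q) *: e'))
  = a - (-1) ^+ (p && q) *: a'
    + (-1) ^+ (r && (p (+) q)) *: (e - (-1) ^+ (p && q) *: e').
Proof.
rewrite !andb_addl andb_addr !signr_addb [q && p]andbC.
set x := (-1) ^+ (r && p); set y := (-1) ^+ (r && q); set z := (-1) ^+ (p && q).
have zz : z * z = 1 by rewrite -expr2 sqrr_sign.
rewrite !(scalerDr, scalerN, scalerA).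
have -> : z * (y * z) = y by rewrite mulrCA zz mulr1.
have -> : z * x = x * z by rewrite mulrC.
have -> : x * y * z = x * z * y by rewrite mulrAC.
rewrite [y * x]mulrC.
set B := _ *: b; set D := _ *: c; set E := _ *: e; set A' := _ *: a'; set E' := _ *: e'.
rewrite (AC (2*2) ((2*3)*(1*4))) [X in _ - X](AC (2*2) ((3*2)*(1*4))) /=.
by rewrite opprD [LHS]addrACA subrr add0r opprD addrACA.
Qed.

Lemma is_der_comm (k l : nat) p q D D' i : is_der k p D -> is_der l q D' ->
  is_der (k + l) (p (+) q) (@der_comm C R p q D D' i).
Proof.
move=> hD hD'; split; first exact: der_comm_homconf (der_homconf hD) (der_homconf hD').
move=> r a b i' j ga; have [Bv hB] := br_eval R.
have [Dv hDv] := homconf_polyop (der_homconf hD).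
have [Dv' hDv'] := homconf_polyop (der_homconf hD').
pose M := mprod (mprod m1 m1) mX.
(* The values of the commutator involve lambda, so its fixed exponent [i] is replaced by a variable
   parameter; the resulting rule is used at [i] only. *)
pose A (l : (unit * unit * nat) * nat) a := @der_comm C R p q D D' l.1.2 a l.2.
pose Av (z : (unit * unit * C) * C) a :=
  Dv (tt, z.1.2) (Dv' (tt, z.2 - z.1.2) a)
  - (-1) ^+ (p && q) *: Dv' (tt, z.2 - z.1.2) (Dv (tt, z.1.2) a).
have hA : polyop (mprod M mX) A Av.
  split.
    move=> u; apply: homconf_coef_lin.
    exact: der_comm_homconf (der_homconf hD) (der_homconf hD').
  move=> c; apply: rep_ext (rep_reindex (f := fun u => (u.1.1, (u.1.2, u.2)))
    (f' := fun u => ((u.1, u.2.1), u.2.2)) (g := fun u => (u.1.1, (u.1.2, u.2)))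
    (mJ := mprod M mX) _ _ _ (polyop_comm p q hDv hDv' c)).
  - by [].
  - by move=> [[[[] []] ?] ?].
  - by move=> [[? ?] ?].
  - by move=> [? [? ?]].
  by move=> [? [? ?]] [[? ?] ?]; rewrite /mprod /= mulrA.
have sM : separating M.
  by do !apply: separating_prod; by [exact: separating1|exact: separatingX].
apply: ((leibniz_eval natC_inj hB a b (iter (k + l) al a) (iter (k + l) al b)
  ((-1) ^+ (r && (p (+) q))) sM hA).2 _ (tt, tt, i) i' j).
move=> [t z] y w; rewrite /Av /=.
have lD := polyop_lin hDv; have lD' := polyop_lin hDv'.
set u := (tt, y - z); set z' := (tt, z).
rewrite (eval_leibniz hB hD' hDv' _ _ _ ga) (linD (lD _)) (linZ (lD _)).
rewrite (eval_leibniz hB hD hDv _ _ _ (eval_gr hD' hDv' u ga)).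
rewrite (eval_leibniz hB hD hDv _ _ _ (gr_iter_al l ga)).
rewrite (eval_leibniz hB hD hDv _ _ _ ga) (linD (lD' _)) (linZ (lD' _)).
rewrite (eval_leibniz hB hD' hDv' _ _ _ (eval_gr hD hDv z' ga)).
rewrite (eval_leibniz hB hD' hDv' _ _ _ (gr_iter_al k ga)).
rewrite !(eval_iter_al hD hDv) !(eval_iter_al hD' hDv') -!iterD [(l + k)%N]addnC /=.
rewrite (linB (Bv_linl hB _ _)) (linZ (Bv_linl hB _ _)).
rewrite (linB (Bv_linr hB _ _)) (linZ (Bv_linr hB _ _)).
(* In either order the two maps shift the parameter of the bracket by z + (y - z) = y in total. *)
have -> : w + (y - z) + z = w + y by rewrite -addrA subrK.
have -> : w + z + (y - z) = w + y by rewrite -addrA [z + _]addrC subrK.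
exact: leibniz_signs.
Qed.
End Commutator.

(** The superspace axioms only assert that homogeneous parts exist. They are chosen here, and their
    uniqueness makes the choice linear. *)
Lemma parity_parts (C : fieldType) (V : lmodType C) (gr : bool -> V -> Prop) :
  is_superspace gr -> exists pr : bool -> V -> V,
  [/\ forall p, lin (pr p), forall p v, gr p (pr p v),
      forall v, v = pr false v + pr true v
    & forall p q v, gr p v -> pr q v = if p == q then v else 0].
Proof.
move=> [g0 gP gS gD].
have /choice[f hf] v : exists f : V * V, [/\ gr false f.1, gr true f.2 & v = f.1 + f.2].
  by have [v0 [v1 h]] := gS v; exists (v0, v1).
have uniq v0 v1 w0 w1 : gr false v0 -> gr true v1 -> gr false w0 -> gr true w1 ->
    v0 + v1 = w0 + w1 -> v0 = w0 /\ v1 = w1.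
  move=> g1 g2 g3 g4 e.
  have e' : v0 - w0 = w1 - v1.
    by apply/eqP; rewrite subr_eq addrAC eq_sym subr_eq e addrC.
  have z : v0 - w0 = 0.
    apply: gD; first by rewrite -scaleN1r addrC; apply: gP.
    by rewrite e' -scaleN1r addrC; apply: gP.
  split; apply/eqP; first by rewrite -subr_eq0 z.
  by rewrite eq_sym -subr_eq0 -e' z.
exists (fun p v => if p then (f v).2 else (f v).1); split.
- move=> p c a b; have [h1 h2 h3] := hf a; have [h4 h5 h6] := hf b.
  have [h7 h8 h9] := hf (c *: a + b).
  have [|||-> ->] := uniq _ _ (c *: (f a).1 + (f b).1) (c *: (f a).2 + (f b).2) h7 h8.
  + exact: gP.
  + exact: gP.
  + by rewrite -h9 {1}h3 {1}h6 scalerDr addrACA.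
  by case: p.
- by move=> [] v; have [] := hf v.
- by move=> v; have [] := hf v.
move=> p q v gv; have [h1 h2 h3] := hf v.
case: p gv => gv.
  have [|||-> ->] := uniq _ _ 0 v h1 h2; by [|rewrite -h3 add0r|case: q].
have [|||-> ->] := uniq _ _ v 0 h1 h2; by [|rewrite -h3 addr0|case: q].
Qed.

(** * Der(R) as a superspace, with the actions of d and of alpha' *)

Section DerSpace.
Variable C : fieldType.
Variable R : homLieConfSuper C.
Local Notation al := (hlcs_al R).
Local Notation gr := (@hlcs_gr C R).
Local Notation br := (@hlcs_br C R).
Implicit Types (X Y Z : Der R) (D : R -> nat -> R).

Lemma der_ext X Y : (forall k a j, X k a j = Y k a j) -> X = Y.
Proof.
move=> h; apply: val_inj; apply/funext => k; apply/funext => a; apply/funext => j.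
exact: h.
Qed.

Lemma der_valE c X Y k a j : (c *: X + Y : Der R) k a j = c *: X k a j + Y k a j.
Proof. by []. Qed.

Lemma der_valD c X Y k : (c *: X + Y : Der R) k = c *: X k + Y k.
Proof. by apply/funext => a; apply/funext => j; rewrite der_valE. Qed.

Lemma der_val0 k : (0 : Der R) k = 0.
Proof. by apply/funext => a; apply/funext => j. Qed.

Lemma is_der_sum (I : Type) (s : seq I) k theta (D : I -> R -> nat -> R) :
  (forall i, is_der k theta (D i)) ->
  is_der k theta (fun a j => \sum_(i <- s) D i a j).
Proof.
move=> h; elim: s => [|i s ih].
  rewrite (_ : (fun _ => _) = 0); first exact: is_der0.
  by apply/funext => a; apply/funext => j; rewrite big_nil.
rewrite (_ : (fun _ => _) = 1 *: D i + (fun a j => \sum_(i <- s) D i a j)).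
  exact: is_der_lin.
by apply/funext => a; apply/funext => j; rewrite big_cons scale1r.
Qed.

(** On a homogeneous vector each coefficient is both even and odd, hence 0, and homogeneous vectors
    span R. *)
Lemma is_der_direct k D : is_der k false D -> is_der k true D -> D = 0.
Proof.
move=> h0 h1; apply/funext => a; apply/funext => n.
have z p b : gr p b -> D b n = 0.
  move=> gb; have := homconf_gr (der_homconf h0) n gb.
  have := homconf_gr (der_homconf h1) n gb.
  by case: p {gb} => /=; [move=> u v|move=> v u]; apply: (gr_direct (gr_super R)).
have [a0 [a1 [g0 g1 ->]]] := gr_sum (gr_super R) a.
rewrite -[a0]scale1r (homconf_lin (der_homconf h0)) (z _ _ g0) (z _ _ g1).
by rewrite scaler0 addr0.
Qed.

Lemma in_DerSum_hom (X : nat -> R -> nat -> R) theta :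
  (forall k, is_der k theta (X k)) -> (exists N, forall k, (N <= k)%N -> X k = 0) ->
  X \in @derSum_pred C R.
Proof.
move=> h hN; apply/asboolP; split=> // k; case: theta h => h.
  by exists 0, (X k); split; [exact: is_der0| |rewrite add0r].
by exists (X k), 0; split; [|exact: is_der0|rewrite addr0].
Qed.

Lemma der_bound X : exists N, forall k, (N <= k)%N -> forall a j, X k a j = 0.
Proof.
have /asboolP [_ [N hN]] := der_valP X; exists N => k /hN e a j.
by rewrite e.
Qed.

Lemma der_super : is_superspace (@der_gr C R).
Proof.
split.
- by move=> p k; rewrite der_val0; exact: is_der0.
- by move=> p c X Y hX hY k; rewrite der_valD; exact: is_der_lin.
- move=> X; have /asboolP [hX [N hN]] := der_valP X.
  have /choice[f hf] k : exists f : (R -> nat -> R) * (R -> nat -> R),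
      [/\ is_der k false f.1, is_der k true f.2 & X k = f.1 + f.2].
    by have [D0 [D1 h]] := hX k; exists (D0, D1).
  (* The parts are chosen separately for each [k], so their finite support needs an argument: where
     X k = 0 the even part is minus the odd part, hence both are 0. *)
  have f0 k : (N <= k)%N -> (f k).1 = 0 /\ (f k).2 = 0.
    move=> /hN e; have [h1 h2 h3] := hf k.
    have e1 : (f k).1 = (-1) *: (f k).2 + 0.
      by apply/eqP; rewrite addr0 scaleN1r -addr_eq0 -h3 e.
    have z : (f k).1 = 0.
      apply: (is_der_direct h1); rewrite e1; apply: is_der_lin => //; exact: is_der0.
    by split=> //; move: h3; rewrite e z add0r => <-.
  have P0 : (fun k => (f k).1) \in @derSum_pred C R.
    apply: (@in_DerSum_hom _ false); first by move=> k; have [] := hf k.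
    by exists N => k /f0[].
  have P1 : (fun k => (f k).2) \in @derSum_pred C R.
    apply: (@in_DerSum_hom _ true); first by move=> k; have [] := hf k.
    by exists N => k /f0[].
  exists (MkDer P0), (MkDer P1); split; try by move=> k; have [] := hf k.
  by apply: der_ext => k a j; have [_ _ ->] := hf k.
move=> X h0 h1; apply: der_ext => k a j.
by rewrite (is_der_direct (h0 k) (h1 k)).
Qed.

(** The bracket is prescribed by a formula on homogeneous elements only, so identities linear in an
    argument are checked on these. *)
Lemma der_hom_ext (V : lmodType C) (f g : Der R -> V) : lin f -> lin g ->
  (forall p X, der_gr p X -> f X = g X) -> forall X, f X = g X.
Proof.
move=> lf lg h X; have [X0 [X1 [h0 h1 ->]]] := gr_sum der_super X.
by rewrite (linD lf) (linD lg) (h _ _ h0) (h _ _ h1).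
Qed.

Lemma der_hom_ind (Q : Der R -> Prop) : (forall X Y, Q X -> Q Y -> Q (X + Y)) ->
  (forall p X, der_gr p X -> Q X) -> forall X, Q X.
Proof.
move=> QD Qh X; have [X0 [X1 [h0 h1 ->]]] := gr_sum der_super X.
by apply: QD; apply: Qh.
Qed.

Lemma mulX_lin (V : lmodType C) (c : C) (x y : nat -> V) n :
  mulX (fun i => c *: x i + y i) n = c *: mulX x n + mulX y n.
Proof. by case: n => //=; rewrite scaler0 addr0. Qed.

Lemma is_der_d k theta D : is_der k theta D -> is_der k theta (fun a j => - mulX (D a) j).
Proof.
move=> hD; have h := der_homconf hD; split; first split.
- move=> c a b n; rewrite (_ : D (c *: a + b) = fun i => c *: D a i + D b i).
    by rewrite mulX_lin opprD scalerN.
  by apply/funext => i; exact: homconf_lin h _ _ _ _.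
- move=> a; have [N hN] := homconf_poly h a; exists N.+1 => -[|n] // Nn.
  by rewrite /= hN ?oppr0.
- move=> a n; case: n => [|n] /=; first by rewrite oppr0 linear0 addr0.
  rewrite (homconf_d h) opprD linearN; congr (_ + _).
- move=> p a n ga; have [g0 gP] := gr_lin R (p (+) theta).
  rewrite -scaleN1r; apply: gr_scale; case: n => [|n] //=.
  exact: homconf_gr h _ _ _ ga.
- move=> a n; rewrite linearN; congr (- _); case: n => [|n] /=; first by rewrite linear0.
  exact: homconf_al h _ _.
move=> p a b i j ga.
have -> : subst_add 1 (fun n m => br (- mulX (D a) n) (iter k al b) m) i j =
    - mulX (fun i => subst_add 1 (fun n m => br (D a n) (iter k al b) m) i j) i.
  rewrite -subst_add_mulXl -scaleN1r -[RHS]addr0.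
  rewrite -[X in _ = _ + X](@subst_add0 C _ 1 (fun _ _ => 0) i j) //.
  rewrite -subst_add_lin; congr subst_add; apply/funext => n; apply/funext => m.
  rewrite addr0; have lb := br_linl (iter k al b) m; rewrite -scaleN1r (linZ lb).
  by congr (_ *: _); case: n => [|n] //=; exact: lin0 lb.
have lb := br_linr (iter k al a) j; rewrite -[- mulX (D b) i]scaleN1r (linZ lb).
rewrite scaleN1r scalerN -opprD; congr (- _); case: i => [|i] /=.
  by rewrite (lin0 lb) scaler0 addr0.
exact: der_leibniz hD _ _ _ _ _ ga.
Qed.

(** Multiplicativity gives D(al [a b]) = D [al a, al b], and the Leibniz rule at [al a] and [al b]
    adds one more power of [al] to the k present. *)
Lemma is_der_al k theta D : multiplicative R -> is_der k theta D ->
  is_der k.+1 theta (fun a j => D (al a) j).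
Proof.
move=> mult hD; have h := der_homconf hD; split; first split.
- by move=> c a b n; rewrite linearP (homconf_lin h).
- by move=> a; exact: homconf_poly h _.
- move=> a n; rewrite (core_al_d (hlcs_to_core (hlcs_axioms R))).
  exact: homconf_d h _ _.
- move=> p a n ga; apply: (homconf_gr h).
  exact: core_al_even (hlcs_to_core (hlcs_axioms R)) _ _ ga.
- by move=> a n; rewrite (homconf_al h).
move=> p a b i j ga; rewrite mult.
rewrite (der_leibniz hD _ _ _ (core_al_even (hlcs_to_core (hlcs_axioms R)) ga)).
by rewrite -!iterSr.
Qed.

Lemma der_d_proof X : (fun k a j => - mulX (X k a) j) \in @derSum_pred C R.
Proof.
have [X0 [X1 [h0 h1 e]]] := gr_sum der_super X.
have P p Y : der_gr p Y -> (fun k a j => - mulX (Y k a) j) \in @derSum_pred C R.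
  move=> hY; apply: (@in_DerSum_hom _ p) => [k|]; first exact: is_der_d.
  have [N hN] := der_bound Y; exists N => k /hN z; apply/funext => a; apply/funext => j.
  by case: j => [|j] /=; rewrite ?z oppr0.
rewrite (_ : (fun _ => _) = (fun k a j => - mulX (X0 k a) j) +
    (fun k a j => - mulX (X1 k a) j)).
  by apply: rpredD; [exact: P h0|exact: P h1].
apply/funext => k; apply/funext => a; apply/funext => j.
change (- mulX (X k a) j = - mulX (X0 k a) j - mulX (X1 k a) j).
rewrite e; change (- mulX (fun n => X0 k a n + X1 k a n) j = - mulX (X0 k a) j - mulX (X1 k a) j).
by case: j => [|j] /=; rewrite ?oppr0 ?addr0 // opprD.
Qed.

Definition der_d X : Der R := MkDer (der_d_proof X).

Lemma der_al_proof (mult : multiplicative R) X :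
  (fun k a j => if k is k'.+1 then X k' (al a) j else 0) \in @derSum_pred C R.
Proof.
have [X0 [X1 [h0 h1 e]]] := gr_sum der_super X.
have P p Y : der_gr p Y ->
    (fun k a j => if k is k'.+1 then Y k' (al a) j else 0) \in @derSum_pred C R.
  move=> hY; apply: (@in_DerSum_hom _ p) => [[|k]|].
  - exact: is_der0.
  - exact: is_der_al.
  have [N hN] := der_bound Y; exists N.+1 => -[|k] // Nk.
  by apply/funext => a; apply/funext => j; rewrite hN.
rewrite (_ : (fun _ => _) = (fun k a j => if k is k'.+1 then X0 k' (al a) j else 0) +
    (fun k a j => if k is k'.+1 then X1 k' (al a) j else 0)).
  by apply: rpredD; [exact: P h0|exact: P h1].
apply/funext => k; apply/funext => a; apply/funext => j.
change (match k with 0%N => 0 | k'.+1 => X k' (al a) j end =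
  match k with 0%N => 0 | k'.+1 => X0 k' (al a) j end +
  match k with 0%N => 0 | k'.+1 => X1 k' (al a) j end).
by rewrite e; case: k => [|k]; rewrite ?addr0.
Qed.

Definition der_al mult X : Der R := MkDer (der_al_proof mult X).

Lemma der_d_linear : lin der_d.
Proof.
move=> c X Y; apply: der_ext => k a j.
change (- mulX (fun n => c *: X k a n + Y k a n) j =
  c *: - mulX (X k a) j - mulX (Y k a) j).
by rewrite mulX_lin opprD scalerN.
Qed.

Lemma der_al_linear mult : lin (der_al mult).
Proof.
move=> c X Y; apply: der_ext => -[|k] a j //.
by change (0 = c *: (0 : R) + 0); rewrite scaler0 addr0.
Qed.

HB.instance Definition _ := GRing.isLinear.Build C (Der R) (Der R) *:%R der_d der_d_linear.
HB.instance Definition _ mult :=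
  GRing.isLinear.Build C (Der R) (Der R) *:%R (der_al mult) (der_al_linear mult).

End DerSpace.

(** * Construction of the bracket on Der(R) *)

Section Bracket.
Variable C : fieldType.
Hypothesis natC_inj : injective (fun n => n%:R : C).
Variable R : homLieConfSuper C.
Implicit Types (X Y Z : Der R) (D : R -> nat -> R).

(** The degrees of two derivations add up under the commutator, so components are convolved. The
    parities are arguments because they fix the sign, and [X], [Y] are bare families because
    membership in Der(R) is proved afterwards. *)
Definition brh p q (X Y : nat -> R -> nat -> R) (i m : nat) (a : R) (j : nat) : R :=
  \sum_(k < m.+1) der_comm p q (X k) (Y (m - k)%N) i a j.

Lemma brh_in p q X Y i : der_gr p X -> der_gr q Y ->
  exists Z, der_gr (p (+) q) Z /\ forall m a j, Z m a j = brh p q X Y i m a j.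
Proof.
move=> hX hY.
have hZ m : is_der m (p (+) q) (brh p q X Y i m).
  apply: is_der_sum => k; have km : (k <= m)%N by rewrite -ltnS.
  by have := is_der_comm natC_inj i (hX k) (hY (m - k)%N); rewrite subnKC.
suff P : brh p q X Y i \in @derSum_pred C R by exists (MkDer P).
apply: in_DerSum_hom hZ _.
(* If m is at least N + M, then k >= N or m - k >= M, so one of the two factors is zero. *)
have [N hN] := der_bound X; have [M hM] := der_bound Y; exists (N + M)%N => m mN.
apply/funext => a; apply/funext => j; apply: big1 => k _; rewrite /der_comm.
have lX n : lin (fun a => X k a n) := homconf_coef_lin n (der_homconf (hX k)).
have lY l n : lin (fun a => Y l a n) := homconf_coef_lin n (der_homconf (hY l)).
have z : forall n m', X k (Y (m - k)%N a m') n = 0 /\ Y (m - k)%N (X k a n) m' = 0.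
  move=> n m'; case: (leqP N k) => kN; first by rewrite !(hN _ kN) (lin0 (lY _ _)).
  have kM : (M <= m - k)%N.
    rewrite leq_subRL; last exact: leq_trans (ltnW kN) (leq_trans (leq_addr _ _) mN).
    by apply: leq_trans mN; rewrite leq_add2r ltnW.
  by rewrite !(hM _ kM) (lin0 (lX _)).
rewrite !subst_add0 ?scaler0 ?subr0 // => n m'; by have [] := z n m'.
Qed.

Lemma brh_linl p q X X' Y c i m a j : (forall k, is_der k q (Y k)) ->
  brh p q (c *: X + X') Y i m a j = c *: brh p q X Y i m a j + brh p q X' Y i m a j.
Proof.
move=> hY; rewrite /brh scaler_sumr -big_split /=; apply: eq_bigr => k _.
rewrite /der_comm.
have -> : subst_add (-1) (fun n u => (c *: X + X') k (Y (m - k)%N a u) n) i j =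
  c *: subst_add (-1) (fun n u => X k (Y (m - k)%N a u) n) i j +
  subst_add (-1) (fun n u => X' k (Y (m - k)%N a u) n) i j by rewrite -subst_add_lin.
have -> : subst_add (-1) (fun n => Y (m - k)%N ((c *: X + X') k a n)) i j =
  c *: subst_add (-1) (fun n => Y (m - k)%N (X k a n)) i j +
  subst_add (-1) (fun n => Y (m - k)%N (X' k a n)) i j.
  rewrite -subst_add_lin; congr subst_add; apply/funext => u; apply/funext => v.
  by rewrite der_valE (homconf_lin (der_homconf (hY _))).
rewrite scalerDr opprD addrACA scalerBr !scalerA; congr (_ - _ *: _ + _).
exact: mulrC.
Qed.

Lemma brh_linr p q X Y Y' c i m a j : (forall k, is_der k p (X k)) ->
  brh p q X (c *: Y + Y') i m a j = c *: brh p q X Y i m a j + brh p q X Y' i m a j.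
Proof.
move=> hX; rewrite /brh scaler_sumr -big_split /=; apply: eq_bigr => k _.
rewrite /der_comm.
have -> : subst_add (-1) (fun n u => (X k) ((c *: Y + Y') (m - k)%N a u) n) i j =
  c *: subst_add (-1) (fun n u => X k (Y (m - k)%N a u) n) i j +
  subst_add (-1) (fun n u => X k (Y' (m - k)%N a u) n) i j.
  rewrite -subst_add_lin; congr subst_add; apply/funext => u; apply/funext => v.
  by rewrite der_valE (homconf_lin (der_homconf (hX _))).
have -> : subst_add (-1) (fun n => (c *: Y + Y') (m - k)%N (X k a n)) i j =
  c *: subst_add (-1) (fun n => Y (m - k)%N (X k a n)) i j +
  subst_add (-1) (fun n => Y' (m - k)%N (X k a n)) i j by rewrite -subst_add_lin.
rewrite scalerDr opprD addrACA scalerBr !scalerA; congr (_ - _ *: _ + _).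
exact: mulrC.
Qed.

(** One homogeneous bracket is chosen for each pair of parities; the sum over the four pairs,
    applied to the parity parts, is bilinear. *)
Lemma der_bracket : exists brD : Der R -> Der R -> nat -> Der R,
  [/\ forall Y i, lin (fun X => brD X Y i), forall X i, lin (fun Y => brD X Y i),
      extends_der_comm brD
    & forall p q X Y i, der_gr p X -> der_gr q Y -> der_gr (p (+) q) (brD X Y i)].
Proof.
have [pr [prl prg prD prE]] := parity_parts (der_super R).
have /choice[f hf] (t : (bool * bool) * (Der R * Der R) * nat) : exists Z,
    der_gr t.1.1.1 t.1.2.1 -> der_gr t.1.1.2 t.1.2.2 ->
    der_gr (t.1.1.1 (+) t.1.1.2) Z /\
    forall m a j, Z m a j = brh t.1.1.1 t.1.1.2 t.1.2.1 t.1.2.2 t.2 m a j.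
  (* For arguments without the stated parities the condition is void, and 0 is taken. *)
  case: t => [[[p q] [X Y]] i] /=.
  case: (pselect (der_gr p X)) => hX; last by exists 0.
  case: (pselect (der_gr q Y)) => hY; last by exists 0.
  by have [Z hZ] := brh_in i hX hY; exists Z.
pose g p q X Y i := f ((p, q), (X, Y), i).
have gE p q X Y i m a j : der_gr p X -> der_gr q Y -> g p q X Y i m a j = brh p q X Y i m a j.
  by move=> hX hY; have [] := hf ((p, q), (X, Y), i) hX hY.
pose gg p q X Y i := g p q (pr p X) (pr q Y) i.
have ggl p q Y i : lin (fun X => gg p q X Y i).
  move=> c X X'; apply: der_ext => m a j.
  change (gg p q (c *: X + X') Y i m a j = c *: gg p q X Y i m a j + gg p q X' Y i m a j).
  rewrite /gg !gE //; rewrite prl; exact: brh_linl (prg q Y).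
have ggr p q X i : lin (fun Y => gg p q X Y i).
  move=> c Y Y'; apply: der_ext => m a j.
  change (gg p q X (c *: Y + Y') i m a j = c *: gg p q X Y i m a j + gg p q X Y' i m a j).
  rewrite /gg !gE //; rewrite prl; exact: brh_linr (prg p X).
pose brD X Y i := \sum_(pq : bool * bool) gg pq.1 pq.2 X Y i.
have brE p q X Y i : der_gr p X -> der_gr q Y -> brD X Y i = g p q X Y i.
  move=> hX hY; rewrite /brD (bigD1 (p, q)) //= big1 => [|[p' q'] ne].
    by rewrite addr0 /gg !(prE _ _ _ hX) !(prE _ _ _ hY) !eqxx.
  (* For every other pair of parities one of the two projections is zero, so only the summand at
     [(p, q)] remains. *)
  have e : pr p' X = 0 \/ pr q' Y = 0.
    rewrite (prE _ _ _ hX) (prE _ _ _ hY); move: ne; rewrite /= xpair_eqE eq_sym.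
    case: eqP => //= _; last by left.
    by rewrite eq_sym; case: eqP => // _; right.
  case: e => e.
    have <- : gg p' q' 0 Y i = gg p' q' X Y i by rewrite /gg e (lin0 (prl p')).
    exact: lin0 (ggl _ _ _ _).
  have <- : gg p' q' X 0 i = gg p' q' X Y i by rewrite /gg e (lin0 (prl q')).
  exact: lin0 (ggr _ _ _ _).
exists brD; split.
- move=> Y i c X X'; rewrite /brD scaler_sumr -big_split /=.
  by apply: eq_bigr => pq _; exact: ggl.
- move=> X i c Y Y'; rewrite /brD scaler_sumr -big_split /=.
  by apply: eq_bigr => pq _; exact: ggr.
- by move=> p q X Y hX hY i m a j; rewrite (brE p q) // gE.
move=> p q X Y i hX hY; rewrite (brE p q) //.
by have [] := hf ((p, q), (X, Y), i) hX hY.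
Qed.

End Bracket.

(** * Evaluation of elements of Der(R) in the degree and in lambda *)

Section Evaluation.
Variable C : fieldType.
Variable R : homLieConfSuper C.
Local Notation d := (hlcs_d R).
Local Notation al := (hlcs_al R).
Local Notation mX := (@mX C).
Local Notation m1 := (@m1 C).
Implicit Types (X Y Z : Der R) (D : R -> nat -> R).

Lemma der_linear X k n : lin (fun a => X k a n).
Proof.
elim/der_hom_ind: X => [X Y hX hY c a b|p X hX c a b].
  change (X k (c *: a + b) n + Y k (c *: a + b) n =
    c *: (X k a n + Y k a n) + (X k b n + Y k b n)).
  by rewrite hX hY scalerDr addrACA.
exact: homconf_lin (der_homconf (hX k)) _ _ _ _.
Qed.

Lemma der_commutes_al X k a n : X k (al a) n = al (X k a n).
Proof.
elim/der_hom_ind: X => [X Y hX hY|p X hX].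
  change (X k (al a) n + Y k (al a) n = al (X k a n + Y k a n)).
  by rewrite hX hY linearD.
exact: homconf_al (der_homconf (hX k)) _ _.
Qed.

Lemma der_commutes_d X k a n : X k (d a) n = d (X k a n) + mulX (X k a) n.
Proof.
elim/der_hom_ind: X => [X Y hX hY|p X hX].
  change (X k (d a) n + Y k (d a) n =
    d (X k a n + Y k a n) + mulX (fun i => X k a i + Y k a i) n).
  rewrite hX hY linearD addrACA; congr (_ + _).
  by case: n {hX hY} => //=; rewrite addr0.
exact: homconf_d (der_homconf (hX k)) _ _.
Qed.

Lemma der_poly X k a : fin_supp (X k a).
Proof.
elim/der_hom_ind: X => [X Y [N hN] [M hM]|p X hX].
  exists (maxn N M) => n; rewrite geq_max => /andP[n1 n2].
  by change (X k a n + Y k a n = 0); rewrite hN ?hM ?addr0.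
exact: homconf_poly (der_homconf (hX k)) _.
Qed.

Lemma der_eval_lin k a n : lin (fun X => X k a n).
Proof. by move=> c X Y; rewrite der_valE. Qed.

Lemma der_subst_add (s : C) (x : nat -> nat -> Der R) i j k a n :
  (subst_add s x i j : Der R) k a n = subst_add s (fun u v => x u v k a n) i j.
Proof.
rewrite /subst_add (lin_sum (der_eval_lin k a n)); apply: eq_bigr => t _.
exact: linZ (der_eval_lin k a n) _ _.
Qed.

Lemma der_polyop X : exists Xv,
  polyop (mprod (mprod m1 mX) mX) (fun i a => X i.1.2 a i.2) Xv.
Proof.
have [N hN] := der_bound X.
have h a : exists F, rep (mprod (mprod m1 mX) mX) (fun i => X i.1.2 a i.2) F.
  have /choice[f hf] k := fin_supp_rep (der_poly X k a).
  have h1 := rep_sum (iota 0 N) (fun k => rep_tensor mX k (hf k)).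
  exists (fun p => \sum_(k <- iota 0 N) mX k p.1.2 *: f k p.2).
  apply: (@rep_ext _ _ _ _ _ _ _ _ _ _ (fun=> erefl)
    (rep_reindex (f := fun i => (i.1.2, i.2)) (f' := fun i => ((tt, i.1), i.2))
    (g := fun i => (i.1.2, i.2)) (mJ := mprod (mprod m1 mX) mX) _ _ _ h1)).
  - move=> [[[] k] n] /=; case: (ltnP k N) => kN.
      rewrite (bigD1_seq k) ?iota_uniq ?mem_iota //= /delta eqxx big1 ?addr0 // => l.
      by rewrite eq_sym => /negPf ->.
    rewrite hN // big_seq big1 // => l; rewrite mem_iota /= add0n /delta => lN.
    by case: eqP => // e; rewrite ltnNge -e kN in lN.
  - by move=> [[[] k] n].
  - by move=> [k n].
  by move=> [k n] [[[] t] z]; rewrite /mprod /m1 /= mul1r.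
have /choice[f hf] := h.
exists (fun p a => f a p); split=> // i; exact: der_linear.
Qed.

Lemma polyop_commutes_al X Xv :
  polyop (mprod (mprod m1 mX) mX) (fun i a => X i.1.2 a i.2) Xv ->
  forall p a, Xv p (al a) = al (Xv p a).
Proof.
move=> [_ h] p a; have lal : lin al by move=> c u v; exact: linearP.
apply: (rep_fun (h (al a)) (rep_ext _ (fun=> erefl) (rep_map lal (h a)))) => i /=.
by rewrite der_commutes_al.
Qed.

Lemma polyop_der_al (mult : multiplicative R) X Xv :
  polyop (mprod (mprod m1 mX) mX) (fun i a => X i.1.2 a i.2) Xv ->
  polyop (mprod (mprod m1 mX) mX) (fun i a => der_al mult X i.1.2 a i.2)
    (fun p a => p.1.2 *: Xv p (al a)).
Proof.
move=> [_ h]; split=> [i|a]; first exact: der_linear.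
(* The scalar t is absorbed into the monomials, so that the shift of the degree becomes a
   substitution along the identity of the points, to which [rep_push] applies. *)
pose M (i : unit * nat * nat) (p : unit * C * C) := p.1.2 * mprod (mprod m1 mX) mX i p.
have h1 : rep M (fun i => X i.1.2 (al a) i.2) (fun p => p.1.2 *: Xv p (al a)).
  have [s [us x0 hs]] := h (al a); exists s; split=> // p.
  by rewrite hs scaler_sumr; apply: eq_bigr => i _; rewrite scalerA.
pose S (x : unit * nat * nat -> R) i := if i.1.2 is k.+1 then x ((i.1.1, k), i.2) else 0.
have h2 := rep_push (S := S) (g := id) (mJ := mprod (mprod m1 mX) mX) _ _ _ h1.
apply: rep_ext (h2 _ _ _).
- by move=> [[[] [|k]] n].
- by [].
- by move=> x y [[[] [|k]] n]; rewrite /S /= ?addr0.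
- by move=> [[[] [|k]] n].
move=> [[[] k] n] v.
apply: rep_ext (rep_delta _ ((tt, k.+1), n) v).
  by move=> [[[] [|k']] n']; rewrite /S /delta /= ?xpair_eqE.
by move=> [[[] t] z]; rewrite /M /mprod /mX /= exprS; congr (_ *: _); ring.
Qed.

(** The variables are, from the inside out, the parameters of the two families, lambda, the degree
    scalar t and mu. Convolution in the degree means that both families are evaluated at the same
    t. *)
Lemma polyop_brh p q (I J : eqType) P Q (m : I -> P -> C) (m' : J -> Q -> C) A Av B Bv :
  polyop (mprod (mprod m mX) mX) A Av -> polyop (mprod (mprod m' mX) mX) B Bv ->
  polyop (R := R) (mprod (mprod (mprod (mprod m m') mX) mX) mX)
    (fun u a => brh p q (fun k a n => A ((u.1.1.1.1, k), n) a)
       (fun k a n => B ((u.1.1.1.2, k), n) a) u.1.1.2 u.1.2 a u.2)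
    (fun r a => Av ((r.1.1.1.1, r.1.2), r.1.1.2)
          (Bv ((r.1.1.1.2, r.1.2), r.2 - r.1.1.2) a)
      - (-1) ^+ (p && q) *: Bv ((r.1.1.1.2, r.1.2), r.2 - r.1.1.2)
          (Av ((r.1.1.1.1, r.1.2), r.1.1.2) a)).
Proof.
move=> hA hB; split=> [u|a].
  have [lA _] := hA; have [lB _] := hB.
  move=> c a b; rewrite /brh scaler_sumr -big_split; apply: eq_bigr => k _ /=.
  by apply: der_comm_lin => n; [exact: lA|exact: lB].
pose M := mprod (mprod (mprod (mprod m m') mX) mX) mX.
pose f (u : ((I * J) * nat * nat) * nat) := ((u.1.1.1, u.1.2), (u.1.1.2, u.2)).
pose f' (u : ((I * J) * nat) * (nat * nat)) := (((u.1.1, u.2.1), u.1.2), u.2.2).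
pose g (u : ((P * Q) * C * C) * C) := ((u.1.1.1, u.1.2), (u.1.1.2, u.2)).
have h := rep_reindex (f := f) (f' := f') (g := g) (mJ := M) _ _ _
  (rep_conv (polyop_comm p q hA hB a)).
apply: h; try by move=> [[[? ?] ?] [? ?]].
  by move=> [[[[? ?] ?] ?] ?].
by move=> [[[? ?] ?] [? ?]] [[[[? ?] ?] ?] ?]; rewrite /M /mprod /=; ring.
Qed.

End Evaluation.

(** Since [al] commutes with the three maps, every term carries exactly one factor [t] and one [al];
    what remains is the Jacobi identity for supercommutators. *)
Lemma jacobi_ops (C : fieldType) (V : lmodType C) (p q r : bool) (x y u al : V -> V)
    (t : C) (a : V) : lin x -> lin y -> lin u ->
    (forall b, x (al b) = al (x b)) -> (forall b, y (al b) = al (y b)) ->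
    (forall b, u (al b) = al (u b)) -> lin al ->
  t *: x (al (y (u a) - (-1) ^+ (q && r) *: u (y a)))
    - (-1) ^+ (p && (q (+) r)) *:
        (y (u (t *: x (al a))) - (-1) ^+ (q && r) *: u (y (t *: x (al a)))) =
  (x (y (t *: u (al a))) - (-1) ^+ (p && q) *: y (x (t *: u (al a))))
    - (-1) ^+ ((p (+) q) && r) *:
        (t *: u (al (x (y a) - (-1) ^+ (p && q) *: y (x a))))
  + (-1) ^+ (p && q) *:
    (t *: y (al (x (u a) - (-1) ^+ (p && r) *: u (x a)))
    - (-1) ^+ (q && (p (+) r)) *:
        (x (u (t *: y (al a))) - (-1) ^+ (p && r) *: u (x (t *: y (al a))))).
Proof.
move=> lx ly lu hx hy hu lal.
rewrite !(linB lal) !(linZ lal) !(linB lx, linB ly, linB lu) !(linZ lx, linZ ly, linZ lu).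
rewrite !(=^~ hx, =^~ hy, =^~ hu) !andb_addr andb_addl !signr_addb [q && p]andbC.
set s := (-1) ^+ (p && q); set s' := (-1) ^+ (p && r); set s'' := (-1) ^+ (q && r).
have ss : s * s = 1 by rewrite -expr2 sqrr_sign.
have ss' : s' * s' = 1 by rewrite -expr2 sqrr_sign.
rewrite !(scalerDr, scalerN, scalerA, opprD, opprK, mulrA) ss mul1r.
have -> : s' * s'' * t * s = s * s' * s'' * t by rewrite mulrC !mulrA.
have -> : s * t * s' = s * s' * t by rewrite mulrAC.
have -> : s'' * s' * t = s' * s'' * t by rewrite [s'' * s']mulrC.
have -> : s'' * t = t * s'' by rewrite mulrC.
set A := t *: _; set B := _ *: x (u _); set D := (s * s' * t) *: _.
set E := _ *: u (y _); set F := _ *: y (x _); set G := _ *: u (x _).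
(* Of the eight terms on the right, two pairs cancel and the other four are those on the left. *)
rewrite [RHS](AC ((2*2)*(2*2)) (((1*7)*(6*4))*((2*5)*(3*8)))) /=.
by rewrite !addNr !addr0.
Qed.

(** * The axioms for the bracket on Der(R) *)

Section DerBracket.
Variable C : fieldType.
Hypothesis natC_inj : injective (fun n => n%:R : C).
Variable R : homLieConfSuper C.
Local Notation d := (hlcs_d R).
Local Notation al := (hlcs_al R).
Local Notation mX := (@mX C).
Local Notation m1 := (@m1 C).
Implicit Types (X Y Z : Der R) (D : R -> nat -> R).
Variable brD : Der R -> Der R -> nat -> Der R.
Hypothesis brD_linl : forall Y i, lin (fun X => brD X Y i).
Hypothesis brD_linr : forall X i, lin (fun Y => brD X Y i).
Hypothesis brD_ext : extends_der_comm brD.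
Hypothesis brD_gr : forall p q X Y i, der_gr p X -> der_gr q Y ->
  der_gr (p (+) q) (brD X Y i).

Lemma brDE p q X Y i m a j : der_gr p X -> der_gr q Y ->
  brD X Y i m a j = brh p q X Y i m a j.
Proof. by move=> hX hY; exact: brD_ext hX hY i m a j. Qed.

(** The bound depends on [a] but not on the degree or on the exponent of mu, because the support is
    finite jointly in all exponents. *)
Lemma brD_poly X Y a : exists N, forall n, (N <= n)%N -> forall k j, brD X Y n k a j = 0.
Proof.
elim/der_hom_ind: X => [X X' [N hN] [M hM]|p X hX].
  exists (maxn N M) => n; rewrite geq_max => /andP[n1 n2] k j.
  rewrite (linD (brD_linl Y n)).
  by change (brD X Y n k a j + brD X' Y n k a j = 0); rewrite hN ?hM ?addr0.
elim/der_hom_ind: Y => [Y Y' [N hN] [M hM]|q Y hY].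
  exists (maxn N M) => n; rewrite geq_max => /andP[n1 n2] k j.
  rewrite (linD (brD_linr X n)).
  by change (brD X Y n k a j + brD X Y' n k a j = 0); rewrite hN ?hM ?addr0.
have [Xv hXv] := der_polyop X; have [Yv hYv] := der_polyop Y.
have [_ h] := polyop_brh p q hXv hYv.
have [N hN] := rep_fin_supp (fun u => u.1.1.2) (h a).
exists N => n Nn k j; rewrite (brDE _ _ _ _ hX hY).
exact: (hN ((((tt, tt), n), k), j)).
Qed.

Lemma brD_fin_supp : finitely_generated R -> forall X Y, fin_supp (brD X Y).
Proof.
move=> [s hs] X Y.
have [N hN] : exists N, forall n, (N <= n)%N -> forall b, b \in s ->
    forall k j, brD X Y n k b j = 0.
  elim: s {hs} => [|b s [N hN]]; first by exists 0%N.
  have [M hM] := brD_poly X Y b; exists (maxn N M) => n.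
  rewrite geq_max => /andP[n1 n2] b'; rewrite inE => /predU1P[->|bs] k j.
    exact: hM.
  exact: hN.
exists N => n Nn; apply: der_ext => k v j.
have [f ->] := hs v; rewrite (lin_sum (der_linear _ _ _)) big1 // => i _.
rewrite (lin_sum (der_linear _ _ _)) big1 // => l _.
rewrite (linZ (der_linear _ _ _)).
suff -> : brD X Y n k (iter l d s`_i) j = 0 by rewrite scaler0.
have E n' : forall j, brD X Y n k (iter n' d s`_i) j = 0.
  elim: n' => [|n' ih] j' /=; first by apply: hN => //; exact: mem_nth.
  by rewrite der_commutes_d ih linear0 add0r; case: j'.
exact: E.
Qed.

Lemma der_gr_d p X : der_gr p X -> der_gr p (der_d X).
Proof. by move=> h k; exact: is_der_d. Qed.

Lemma der_gr_al mult p X : der_gr p X -> der_gr p (der_al mult X).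
Proof. by move=> h [|k]; [exact: is_der0|exact: is_der_al]. Qed.

Lemma der_comm_dl p q D D' i a j : (forall n, lin (D'^~ n)) ->
  @der_comm C R p q (fun a n => - mulX (D a) n) D' i a j =
  - mulX (fun i => der_comm p q D D' i a j) i.
Proof.
move=> lD'; rewrite /der_comm.
have N0 (x : nat -> nat -> R) : subst_add (-1) (fun n m => - mulX (x^~ m) n) i j =
    - mulX (fun i => subst_add (-1) x i j) i.
  rewrite -subst_add_mulXl /subst_add -sumrN; apply: eq_bigr => t _.
  by rewrite scalerN.
rewrite (N0 (fun n m => D (D' a m) n)).
have -> : subst_add (-1) (fun n m => D' (- mulX (D a) n) m) i j =
    - mulX (fun i => subst_add (-1) (fun n m => D' (D a n) m) i j) i.
  rewrite -N0; apply: eq_bigr => t _; congr (_ *: _).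
  rewrite -scaleN1r (linZ (lD' _)) scaleN1r; congr (- _).
  by case: (i - t)%N => //=; rewrite (lin0 (lD' _)).
case: i {N0} => [|i] /=; first by rewrite !oppr0 scaler0 subr0.
by rewrite scalerN -opprD.
Qed.

(** D' is taken at mu - lambda, so d acting on it gives the factor -(mu - lambda): the part -mu is d
    acting on the bracket, the part lambda the additional term of the axiom. *)
Lemma der_comm_dr p q D D' i a j : (forall n, lin (D^~ n)) ->
  @der_comm C R p q D (fun a n => - mulX (D' a) n) i a j =
  - mulX (der_comm p q D D' i a) j + mulX (fun i => der_comm p q D D' i a j) i.
Proof.
move=> lD; rewrite /der_comm.
have N0 (x : nat -> nat -> R) : subst_add (-1) (fun n m => - mulX (x n) m) i j =
    - mulX (subst_add (-1) x i) j + mulX (fun i => subst_add (-1) x i j) i.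
  transitivity (- subst_add (-1) (fun n m => mulX (x n) m) i j).
    by rewrite /subst_add -sumrN; apply: eq_bigr => t _; rewrite scalerN.
  by rewrite subst_add_mulXr opprD scaleN1r opprK.
rewrite (N0 (fun n m => D' (D a n) m)).
have -> : subst_add (-1) (fun n m => D (- mulX (D' a) m) n) i j =
    subst_add (-1) (fun n m => - mulX (fun m => D (D' a m) n) m) i j.
  apply: eq_bigr => t _; congr (_ *: _).
  rewrite -scaleN1r (linZ (lD _)) scaleN1r; congr (- _).
  by case: (j + t)%N => //=; rewrite (lin0 (lD _)).
rewrite N0 scalerDr opprD addrACA; congr (_ + _).
  case: j {N0} => [|j] /=; first by rewrite !(oppr0, scaler0, addr0).
  by rewrite scalerN -opprD.
by case: i {N0} => [|i] /=; rewrite ?scaler0 ?subr0.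
Qed.

Lemma brD_dl X Y n : brD (der_d X) Y n = - mulX (brD X Y) n.
Proof.
move: X; apply: (der_hom_ext (f := fun X => brD (der_d X) Y n)
  (g := fun X => - mulX (brD X Y) n)).
- by move=> c X X'; rewrite linearP brD_linl.
- move=> c X X'; case: n => [|n] /=; first by rewrite oppr0 scaler0 addr0.
  by rewrite brD_linl opprD scalerN.
move=> p X hX; move: Y; apply: (der_hom_ext (f := fun Y => brD (der_d X) Y n)
  (g := fun Y => - mulX (brD X Y) n)).
- by move=> c Y Y'; rewrite brD_linr.
- move=> c Y Y'; case: n => [|n] /=; first by rewrite oppr0 scaler0 addr0.
  by rewrite brD_linr opprD scalerN.
move=> q Y hY; apply: der_ext => m a j.
rewrite (brDE _ _ _ _ (der_gr_d hX) hY) /brh.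
transitivity (- mulX (fun n => brh p q X Y n m a j) n).
  transitivity (\sum_(k < m.+1) - mulX (fun i => der_comm p q (X k) (Y (m - k)%N) i a j) n).
    by apply: eq_bigr => k _; apply: der_comm_dl => v; exact: der_linear.
  rewrite sumrN; congr (- _); case: n => [|n] //=; exact: big1.
case: n => [|n] //=.
by change (- brh p q X Y n m a j = - (brD X Y n m a j)); rewrite (brDE _ _ _ _ hX hY).
Qed.

Lemma brD_dr X Y n : brD X (der_d Y) n = der_d (brD X Y n) + mulX (brD X Y) n.
Proof.
move: X; apply: (der_hom_ext (f := fun X => brD X (der_d Y) n)
  (g := fun X => der_d (brD X Y n) + mulX (brD X Y) n)).
- by move=> c X X'; rewrite brD_linl.
- move=> c X X'; rewrite brD_linl linearP scalerDr addrACA; congr (_ + _).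
  by case: n => [|n] /=; [rewrite scaler0 addr0|exact: brD_linl].
move=> p X hX; move: Y; apply: (der_hom_ext (f := fun Y => brD X (der_d Y) n)
  (g := fun Y => der_d (brD X Y n) + mulX (brD X Y) n)).
- by move=> c Y Y'; rewrite linearP brD_linr.
- move=> c Y Y'; rewrite brD_linr linearP scalerDr addrACA; congr (_ + _).
  by case: n => [|n] /=; [rewrite scaler0 addr0|exact: brD_linr].
move=> q Y hY; apply: der_ext => m a j.
rewrite (brDE _ _ _ _ hX (der_gr_d hY)) /brh.
transitivity (- mulX (brh p q X Y n m a) j + mulX (fun n => brh p q X Y n m a j) n).
  transitivity (\sum_(k < m.+1) (- mulX (der_comm p q (X k) (Y (m - k)%N) n a) j +
      mulX (fun i => der_comm p q (X k) (Y (m - k)%N) i a j) n)).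
    by apply: eq_bigr => k _; apply: der_comm_dr => v; exact: der_linear.
  rewrite big_split sumrN; congr (- _ + _).
    by case: j => [|j] //=; exact: big1.
  by case: n => [|n] //=; exact: big1.
change (- mulX (brh p q X Y n m a) j + mulX (fun n => brh p q X Y n m a j) n =
  - mulX (brD X Y n m a) j + (mulX (brD X Y) n : Der R) m a j).
congr (- _ + _).
  by case: j => [|j] //=; rewrite (brDE _ _ _ _ hX hY).
by case: n => [|n] //=; rewrite (brDE _ _ _ _ hX hY).
Qed.

Lemma polyop_ext (I : eqType) P (m : I -> P -> C) (A B : I -> R -> R) Av :
  (forall i a, A i a = B i a) ->
  polyop m A Av -> polyop m B Av.
Proof.
move=> e [lA hA]; split=> [i c a b|a]; first by rewrite -!e lA.
by apply: rep_ext (hA a) => // i; rewrite e.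
Qed.

Lemma polyop_brD p q (I J : eqType) P Q (m : I -> P -> C) (m' : J -> Q -> C)
    (X : I -> Der R) (Y : J -> Der R) Av Bv :
  (forall i, der_gr p (X i)) -> (forall j, der_gr q (Y j)) ->
  polyop (mprod (mprod m mX) mX) (fun u a => X u.1.1 u.1.2 a u.2) Av ->
  polyop (mprod (mprod m' mX) mX) (fun u a => Y u.1.1 u.1.2 a u.2) Bv ->
  polyop (mprod (mprod (mprod (mprod m m') mX) mX) mX)
    (fun u a => brD (X u.1.1.1.1) (Y u.1.1.1.2) u.1.1.2 u.1.2 a u.2)
    (fun r a => Av ((r.1.1.1.1, r.1.2), r.1.1.2)
          (Bv ((r.1.1.1.2, r.1.2), r.2 - r.1.1.2) a)
      - (-1) ^+ (p && q) *: Bv ((r.1.1.1.2, r.1.2), r.2 - r.1.1.2)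
          (Av ((r.1.1.1.1, r.1.2), r.1.1.2) a)).
Proof.
move=> hX hY hA hB; apply: polyop_ext (polyop_brh p q hA hB) => u a /=.
by rewrite (brDE _ _ _ _ (hX _) (hY _)).
Qed.

(* Taking coefficients in the order (mu, lambda) turns mu |-> mu + lambda into
   lambda |-> lambda + mu; with lambda |-> - lambda this is mu - lambda, that is,
   - lambda - d for d acting as - mu. *)
Lemma brD_skew_coef p q X Y k a n j : der_gr p X -> der_gr q Y ->
  brD X Y n k a j = - ((-1) ^+ (p && q) *: ((-1) ^+ n *:
    subst_add 1 (fun u m => brD Y X m k a u) j n)).
Proof.
move=> hX hY; have [Xv hXv] := der_polyop X; have [Yv hYv] := der_polyop Y.
have [_ h1] := polyop_brD (fun=> hX) (fun=> hY) hXv hYv.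
have [_ h2] := polyop_brD (fun=> hY) (fun=> hX) hYv hXv.
pose L := mprod (mprod m1 m1) mX.
pose f (u : (unit * unit * nat) * (nat * nat)) := (((u.1.1, u.2.2), u.1.2), u.2.1).
pose f' (u : ((unit * unit * nat) * nat) * nat) := ((u.1.1.1, u.1.2), (u.2, u.1.1.2)).
pose g (u : (unit * unit * C) * (C * C)) := (((u.1.1, u.2.2), u.1.2), u.2.1).
have ff' : cancel f f' by move=> [[? ?] [? ?]].
have f'f : cancel f' f by move=> [[[? ?] ?] ?].
have fm u v : mprod (mprod (mprod (mprod m1 m1) mX) mX) mX u (g v) =
    mprod L (mprod mX mX) (f' u) v.
  by case: u v => [[[? ?] ?] ?] [[? ?] [? ?]]; rewrite /L /mprod /=; ring.
have {ff' f'f fm} h3 := rep_subst_add 1 (rep_reindex ff' f'f fm (h2 a)).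
(* The exponent of lambda comes first, where [rep_sign] acts on its variable. *)
pose F (u : nat * ((unit * unit * nat) * nat)) := (u.2.1, (u.2.2, u.1)).
pose F' (u : (unit * unit * nat) * (nat * nat)) := (u.2.2, (u.1, u.2.1)).
pose G (u : C * ((unit * unit * C) * C)) := (u.2.1, (u.2.2, u.1)).
have FF' : cancel F F' by move=> [? [? ?]].
have F'F : cancel F' F by move=> [? [? ?]].
have Fm u v : mprod L (mprod mX mX) u (G v) = mprod mX (mprod L mX) (F' u) v.
  by case: u v => [? [? ?]] [? [? ?]]; rewrite /L /mprod /=; ring.
have {FF' F'F Fm h3} h3 :=
  repZ (-1) (repZ ((-1) ^+ (p && q)) (rep_sign (rep_reindex FF' F'F Fm h3))).
pose F1 (u : nat * ((unit * unit * nat) * nat)) := (((u.2.1.1, u.1), u.2.1.2), u.2.2).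
pose F1' (u : ((unit * unit * nat) * nat) * nat) := (u.1.1.2, ((u.1.1.1, u.1.2), u.2)).
pose G1 (u : C * ((unit * unit * C) * C)) := (((u.2.1.1, u.1), u.2.1.2), u.2.2).
have FF' : cancel F1 F1' by move=> [? [[? ?] ?]].
have F'F : cancel F1' F1 by move=> [[[? ?] ?] ?].
have Fm u v : mprod (mprod (mprod (mprod m1 m1) mX) mX) mX u (G1 v) =
    mprod mX (mprod L mX) (F1' u) v.
  by case: u v => [[[? ?] ?] ?] [? [[? ?] ?]]; rewrite /L /mprod /=; ring.
have {FF' F'F Fm}h1 := rep_reindex FF' F'F Fm (h1 a).
have sM : separating (mprod mX (mprod L mX)).
  by do !apply: separating_prod; by [exact: separating1|exact: separatingX].
rewrite -scaleN1r; apply: (rep_inj sM h1 h3 _ (n, (((tt, tt), k), j))).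
move=> [z [[[[] []] t] w]]; rewrite /G1 /G /g /= mul1r.
(* At lambda = w - z the complementary argument is w - (w - z) = z, so the commutator of Y and X
   there has the same two products as that of X and Y at z. *)
have -> : - z + w = w - z by rewrite addrC.
have -> : w - (w - z) = z by rewrite opprB addrC subrK.
rewrite scaleN1r -scalerN opprB [q && p]andbC scalerBr scalerA -expr2 sqrr_sign scale1r.
by [].
Qed.

Lemma iter_der_d r Z k a j : iter r (@der_d C R) Z k a j =
  if (r <= j)%N then (-1) ^+ r *: Z k a (j - r)%N else 0.
Proof.
elim: r j => [|r ih] j; first by rewrite subn0 scale1r.
change (- mulX (iter r (@der_d C R) Z k a) j =
  if (r < j)%N then (-1) ^+ r.+1 *: Z k a (j - r.+1)%N else 0).
case: j => [|j] /=; first by rewrite oppr0.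
rewrite ih ltnS subSS; case: ifP => _; last by rewrite oppr0.
by rewrite exprS mulN1r scaleNr.
Qed.

(** At the coefficient of mu^j only n <= m <= n + j contributes: below, the binomial coefficient
    vanishes; above, (-mu)^(m - n) has too high a degree. Since d acts on derivations without
    changing the degree k or the vector a, a bound [N] valid at this k and a is enough. *)
Lemma brD_skew : pointwise_skew (@der_d C R) brD.
Proof.
move=> p q X Y k a N hX hY hN n.
set W := subst_opp _ _ _ _.
have -> : (- ((-1) ^+ (p && q) *: W) : Der R) k a =
    fun j => - ((-1) ^+ (p && q) *: W k a j).
  by apply/funext => j.
apply/funext => j; rewrite (brD_skew_coef _ _ _ _ hX hY); congr (- (_ *: _)).
pose g m : R := ((-1) ^+ m * 'C(m, n)%:R) *:
  iter (m - n) (@der_d C R) (brD Y X m) k a j.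
have -> : W k a j = \sum_(0 <= m < N) g m.
  rewrite /W /subst_opp (lin_sum (der_eval_lin k a j)) big_mkord.
  apply: eq_bigr => m _; exact: (linZ (der_eval_lin k a j)).
have gN m : (N <= m)%N -> g m = 0.
  move=> Nm; rewrite /g iter_der_d; case: ifP => _; rewrite ?scaler0 //.
  have -> : brD Y X m k a (j - (m - n))%N = 0 by rewrite hN.
  by rewrite !scaler0.
(* The upper end exceeds both [N] and n + j, so neither has to be compared with the other. *)
have <- : \sum_(0 <= m < N + (n + j.+1)) g m = \sum_(0 <= m < N) g m.
  rewrite (big_cat_nat (n := N)) ?leq_addr //= [X in _ + X]big1_seq ?addr0 //.
  by move=> m; rewrite mem_index_iota => /andP[_ /andP[/gN]].
rewrite (big_cat_nat (n := n)) //=; last by rewrite addnCA leq_addr.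
rewrite big1_seq ?add0r; last first.
  move=> m; rewrite mem_index_iota => /andP[_ /andP[_ mn]].
  by rewrite /g bin_small // mulr0 scale0r.
rewrite (big_cat_nat (n := (n + j.+1)%N)) ?leq_addr ?leq_addl //=.
rewrite [X in _ = _ + X]big1_seq ?addr0; last first.
  move=> m; rewrite mem_index_iota => /andP[_ /andP[nm _]].
  have /negPf mj : ~~ (m - n <= j)%N by rewrite -ltnNge ltn_subRL -addnS.
  by rewrite /g iter_der_d mj scaler0.
have -> : \sum_(n <= m < n + j.+1) g m = \sum_(0 <= t < j.+1) g (t + n)%N.
  by rewrite -{1}[n]add0n big_addn addKn.
rewrite big_mkord scaler_sumr; apply: eq_bigr => t _.
have tj : (t <= j)%N by rewrite -ltnS.
rewrite /g iter_der_d addnK tj !scalerA expr1n mul1r addnC.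
congr (_ *: _); rewrite exprD [RHS]mulrC !mulrA -expr2.
by rewrite sqrr_sign mul1r.
Qed.

Lemma brD_jacobi_hom mult p q r X Y Z i j :
  der_gr p X -> der_gr q Y -> der_gr r Z ->
  brD (der_al mult X) (brD Y Z j) i =
    subst_add 1 (fun n m => brD (brD X Y n) (der_al mult Z) m) i j
    + (-1) ^+ (p && q) *: brD (der_al mult Y) (brD X Z i) j.
Proof.
move=> hX hY hZ; apply: der_ext => k a n.
change (brD (der_al mult X) (brD Y Z j) i k a n =
  (subst_add 1 (fun n m => brD (brD X Y n) (der_al mult Z) m) i j : Der R) k a n
  + (-1) ^+ (p && q) *: brD (der_al mult Y) (brD X Z i) j k a n).
rewrite der_subst_add.
have [Xv hXv] := der_polyop X; have [Yv hYv] := der_polyop Y.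
have [Zv hZv] := der_polyop Z.
have [[alX alY] alZ] := (polyop_der_al mult hXv, polyop_der_al mult hYv, polyop_der_al mult hZv).
have [[grX grY] grZ] := (der_gr_al mult hX, der_gr_al mult hY, der_gr_al mult hZ).
pose L := mprod (mprod m1 m1) mX.
have swapL (A B : Der R) s t Av Bv : der_gr s A -> der_gr t B ->
    polyop (mprod (mprod m1 mX) mX) (fun u a => A u.1.2 a u.2) Av ->
    polyop (mprod (mprod m1 mX) mX) (fun u a => B u.1.2 a u.2) Bv ->
  polyop (mprod (mprod L mX) mX) (fun u a => brD A B u.1.1.2 u.1.2 a u.2)
    (fun r a => Av ((tt, r.1.2), r.1.1.2) (Bv ((tt, r.1.2), r.2 - r.1.1.2) a)
      - (-1) ^+ (s && t) *: Bv ((tt, r.1.2), r.2 - r.1.1.2) (Av ((tt, r.1.2), r.1.1.2) a)).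
  move=> hA hB pA pB; have [l1 l2] := polyop_brD (fun=> hA) (fun=> hB) pA pB.
  split=> // b; apply: rep_ext (l2 b) => //.
  by move=> [[[[[] []] z] t'] w].
(* The exponent of the inner bracket is the index of the family that enters the outer one. *)
have [_ h1] := polyop_brD (fun=> grX) (fun u : unit * unit * nat => brD_gr u.2 hY hZ) alX
  (swapL _ _ _ _ _ _ hY hZ hYv hZv).
have [_ h2] := polyop_brD (fun u : unit * unit * nat => brD_gr u.2 hX hY) (fun=> grZ)
  (swapL _ _ _ _ _ _ hX hY hXv hYv) alZ.
have [_ h3] := polyop_brD (fun=> grY) (fun u : unit * unit * nat => brD_gr u.2 hX hZ) alY
  (swapL _ _ _ _ _ _ hX hZ hXv hZv).
(* Common variables for the three terms: the degree scalar and mu, then the two bracket parameters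
   with exponents [i] and [j]. *)
pose M := mprod (mprod mX mX) (mprod mX mX).
pose U := (unit * unit)%type.
pose f1 (u : (nat * nat) * (nat * nat)) :=
  ((((tt, ((tt, tt), u.2.2)), u.2.1), u.1.1), u.1.2).
pose g1 (u : (C * C) * (C * C)) := ((((tt, ((tt, tt), u.2.2)), u.2.1), u.1.1), u.1.2).
pose f1' (u : (unit * (U * nat) * nat * nat) * nat) :=
  ((u.1.2, u.2), (u.1.1.2, u.1.1.1.2.2)).
have c1 : cancel f1 f1' by move=> [[? ?] [? ?]].
have c1' : cancel f1' f1 by move=> [[[[[] [[[] []] ?]] ?] ?] ?].
have e1 u v : mprod (mprod (mprod (mprod m1 L) mX) mX) mX u (g1 v) = M (f1' u) v.
  case: u v => [[[[[] [[[] []] ?]] ?] ?] ?] [[? ?] [? ?]].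
  by rewrite /M /L /mprod /m1 /=; ring.
have {}h1 := rep_reindex c1 c1' e1 (h1 a).
pose f3 (u : (nat * nat) * (nat * nat)) :=
  ((((tt, ((tt, tt), u.2.1)), u.2.2), u.1.1), u.1.2).
pose g3 (u : (C * C) * (C * C)) := ((((tt, ((tt, tt), u.2.1)), u.2.2), u.1.1), u.1.2).
pose f3' (u : (unit * (U * nat) * nat * nat) * nat) :=
  ((u.1.2, u.2), (u.1.1.1.2.2, u.1.1.2)).
have c3 : cancel f3 f3' by move=> [[? ?] [? ?]].
have c3' : cancel f3' f3 by move=> [[[[[] [[[] []] ?]] ?] ?] ?].
have e3 u v : mprod (mprod (mprod (mprod m1 L) mX) mX) mX u (g3 v) = M (f3' u) v.
  case: u v => [[[[[] [[[] []] ?]] ?] ?] ?] [[? ?] [? ?]].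
  by rewrite /M /L /mprod /m1 /=; ring.
have {}h3 := rep_reindex c3 c3' e3 (h3 a).
pose f2 (u : (nat * nat) * (nat * nat)) :=
  ((((((tt, tt), u.2.1), tt), u.2.2), u.1.1), u.1.2).
pose g2 (u : (C * C) * (C * C)) := ((((((tt, tt), u.2.1), tt), u.2.2), u.1.1), u.1.2).
pose f2' (u : ((U * nat) * unit * nat * nat) * nat) :=
  ((u.1.2, u.2), (u.1.1.1.1.2, u.1.1.2)).
have c2 : cancel f2 f2' by move=> [[? ?] [? ?]].
have c2' : cancel f2' f2 by move=> [[[[[[[] []] ?] []] ?] ?] ?].
have e2 u v : mprod (mprod (mprod (mprod L m1) mX) mX) mX u (g2 v) = M (f2' u) v.
  case: u v => [[[[[[[] []] ?] []] ?] ?] ?] [[? ?] [? ?]].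
  by rewrite /M /L /mprod /m1 /=; ring.
have {}h2 := rep_subst_add 1 (rep_reindex c2 c2' e2 (h2 a)).
have h4 := repD h2 (repZ ((-1) ^+ (p && q)) h3).
have sM : separating M by do !apply: separating_prod; exact: separatingX.
apply: (rep_inj sM h1 h4 _ ((k, n), (i, j))).
move=> [[t v] [z w]]; rewrite /g1 /g2 /g3 /= mul1r.
(* In all three terms X, Y and Z are now taken at z, w and v - z - w. *)
have -> : w + z - z = w by rewrite addrK.
have -> : v - (w + z) = v - z - w by rewrite opprD addrA addrAC.
have -> : v - w - z = v - z - w by rewrite addrAC.
apply: (@jacobi_ops C R p q r (Xv ((tt, t), z)) (Yv ((tt, t), w)) (Zv ((tt, t), v - z - w)) al t a).
- exact: (polyop_lin hXv).
- exact: (polyop_lin hYv).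
- exact: (polyop_lin hZv).
- by move=> b; exact: (polyop_commutes_al hXv).
- by move=> b; exact: (polyop_commutes_al hYv).
- by move=> b; exact: (polyop_commutes_al hZv).
by move=> c b b'; exact: linearP.
Qed.

Lemma brD_jacobi mult p q X Y Z i j : der_gr p X -> der_gr q Y ->
  brD (der_al mult X) (brD Y Z j) i =
    subst_add 1 (fun n m => brD (brD X Y n) (der_al mult Z) m) i j
    + (-1) ^+ (p && q) *: brD (der_al mult Y) (brD X Z i) j.
Proof.
move=> hX hY; elim/der_hom_ind: Z => [Z Z' hZ hZ'|r Z hZ]; last exact: brD_jacobi_hom hZ.
rewrite !(linD (brD_linr _ _)) hZ hZ' scalerDr addrACA; congr (_ + _).
rewrite -subst_addD; apply: eq_bigr => t _; congr (_ *: _).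
by rewrite linearD (linD (brD_linr _ _)).
Qed.

End DerBracket.

(** * Assembly of the axioms over the complex numbers *)

Local Open Scope complex_scope.

Lemma natr_complex_inj (K : realType) : injective (fun n => n%:R : K[i]).
Proof. by move=> m n /eqP; rewrite Num.Theory.eqr_nat => /eqP. Qed.

Theorem proposition4p3 (K : realType) (R : homLieConfSuper K[i]) :
  multiplicative R ->
  exists (dD alD : {linear Der R -> Der R}) (brD : Der R -> Der R -> nat -> Der R),
    [/\ acts_by_neg_lambda dD, extends_comp_al alD & extends_der_comm brD]
    /\ [/\ hlcs_core dD alD (@der_gr _ R) brD,
          pointwise_poly brD & pointwise_skew dD brD]
    /\ ((forall X Y, fin_supp (brD X Y)) -> is_hlcs dD alD (@der_gr _ R) brD)
    /\ (finitely_generated R -> is_hlcs dD alD (@der_gr _ R) brD).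
Proof.
move=> mult; have natC_inj := @natr_complex_inj K.
have [brD [bl br' ext brgr]] := der_bracket natC_inj R.
exists (@der_d _ R), (@der_al _ R mult), brD.
have core : hlcs_core (@der_d _ R) (@der_al _ R mult) (@der_gr _ R) brD.
  split.
  - exact: der_super.
  - by move=> p X; exact: der_gr_d.
  - by move=> p X; exact: der_gr_al.
  - move=> X; apply: der_ext => -[|k] a j //.
    by change (0 = - mulX (fun=> 0 : R) j); case: j => [|j] /=; rewrite oppr0.
  - by move=> c X X' Y n; exact: bl.
  - by move=> c X Y Y' n; exact: br'.
  - by move=> p q X Y n hX hY; exact: brgr.
  - by move=> X Y n; exact: brD_dl.
  - by move=> X Y n; exact: brD_dr.
  by move=> p q X Y Z i j hX hY; exact: brD_jacobi.
have skew := brD_skew natC_inj ext.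
have hlcs : (forall X Y, fin_supp (brD X Y)) ->
    is_hlcs (@der_d _ R) (@der_al _ R mult) (@der_gr _ R) brD.
  move=> fin; split=> // p q X Y N hX hY hN n; apply: der_ext => k a j.
  (* A bound on the whole bracket is a bound at every k and a, so skew-symmetry in Der(R) reduces to
     the pointwise one. *)
  by rewrite (skew p q X Y k a N hX hY) // => m Nm; rewrite hN // der_val0.
split; first by split.
split; [split=> //|split=> // fg].
  move=> X Y k a; have [N hN] := brD_poly bl br' ext X Y a.
  by exists N => n Nn; apply/funext => j; exact: hN.
by apply: hlcs => X Y; exact: (brD_fin_supp bl br' ext).
Qed.
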